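(* Let $\mathfrak{q}=\mathfrak{l}\oplus\mathfrak{g}(1)\oplus\mathfrak{z}(\mathfrak{n})$ be a maximal parabolic subalgebra of quasi-Heisenberg type of one of the types $B_n(i)$ ($3\le i\le n$), $C_n(i)$ ($2\le i\le n-1$), $D_n(i)$ ($3\le i\le n-3$), $E_6(3)$, $E_6(5)$, $E_7(2)$, $E_7(6)$, $E_8(1)$, $F_4(4)$, and let $\alpha_\mathfrak{q}$ be the simple root that parametrizes $\mathfrak{q}$. If $V(\mu+\epsilon)$ is a special constituent of $\mathfrak{l}\otimes\mathfrak{z}(\mathfrak{n})$ of type 1a, then for any $\alpha\in\Delta_{\mu+\epsilon}(\mathfrak{g}(1))\setminus\{\mu,\epsilon\}$ and any $\gamma_j\in\Delta_{\mu+\epsilon}(\mathfrak{z}(\mathfrak{n}))$, $$N_{\alpha,-\gamma_j}\,N_{\mu,-\alpha}\,N_{-\theta(\gamma_j),\theta(\alpha)}\,N_{-\theta(\alpha),\theta(\mu)}=N_{\mu,\epsilon-\gamma_j}\,N_{\epsilon,-\gamma_j}\,\frac{\|\alpha_\mathfrak{q}\|^2}{2},$$ where $\theta(\beta)=(\mu+\epsilon)-\beta$.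
   Context: $\mathfrak{g}$ is a complex simple Lie algebra with Borel subalgebra $\mathfrak{b}\supset\mathfrak{h}$ (Cartan), roots $\Delta$, simple roots $\Pi$, Killing form $\kappa$, induced form $\langle\cdot,\cdot\rangle$ on $\mathfrak{h}^*$, $\|\alpha\|^2=\langle\alpha,\alpha\rangle$. ''$\mathfrak{q}$ is of type $\mathcal{T}(i)$'' means $\mathfrak{g}$ has type $\mathcal{T}$ and $\mathfrak{q}=\mathfrak{l}\oplus\mathfrak{n}$ is the standard maximal parabolic determined by $\alpha_\mathfrak{q}=\alpha_i$ (Bourbaki numbering): $\mathfrak{l}=\mathfrak{h}$ plus root spaces for roots in $\mathrm{span}(\Pi\setminus\{\alpha_\mathfrak{q}\})$, $\mathfrak{n}$ the remaining positive root spaces. Quasi-Heisenberg type: $[\mathfrak{n},[\mathfrak{n},\mathfrak{n}]]=0$, $\dim[\mathfrak{n},\mathfrak{n}]>1$. $\mathfrak{n}=\mathfrak{g}(1)\oplus\mathfrak{z}(\mathfrak{n})$, where $\mathfrak{g}(1)$ (resp. the center $\mathfrak{z}(\mathfrak{n})$) is the sum of the root spaces of roots with $\alpha_\mathfrak{q}$-coefficient $1$ (resp. $2$). $L$ is the Levi subgroup with Lie algebra $\mathfrak{l}$, acting by $\mathrm{Ad}$. $\Delta(W)$ denotes the roots whose root spaces lie in $W$, and $\Delta_\nu(W)=\{\alpha\in\Delta(W):\nu-\alpha\in\Delta\}$. $\mu$ is the highest weight of the irreducible $L$-module $\mathfrak{g}(1)$ and $\gamma$ (the highest root) that of $\mathfrak{z}(\mathfrak{n})$.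 An irreducible $L$-constituent $V(\nu)$ (highest weight $\nu$) of $\mathfrak{l}\otimes\mathfrak{z}(\mathfrak{n})$ is special if $\nu\neq\gamma$ and $\nu=\mu+\epsilon$ for some $\epsilon\in\Delta(\mathfrak{g}(1))$; it is of type 1a if $\mu+\epsilon\notin\Delta$, $\epsilon\neq\mu$, and both $\mu$ and $\epsilon$ are long roots (all roots are regarded as long if $\mathfrak{g}$ is simply laced). Normalization. Root vectors $X_\alpha\in\mathfrak{g}_\alpha$ and $H_\alpha\in\mathfrak{h}$ ($\alpha\in\Delta$) are chosen with $[X_\alpha,X_{-\alpha}]=H_\alpha$, $\kappa(X_\alpha,X_{-\alpha})=1$, $\beta(H_\alpha)=\langle\alpha,\beta\rangle$; $[X_\alpha,X_\beta]=N_{\alpha,\beta}X_{\alpha+\beta}$ if $\alpha+\beta\in\Delta$, and $N_{\alpha,\beta}=0$ if $\alpha+\beta\notin\Delta$, $\alpha+\beta\neq0$; $N_{\alpha_1,\alpha_2}=N_{\alpha_2,\alpha_3}=N_{\alpha_3,\alpha_1}$ for roots with $\alpha_1+\alpha_2+\alpha_3=0$; and $N_{\alpha,\beta}N_{-\alpha,-\beta}=-\frac{q_{\alpha,\beta}(1+p_{\alpha,\beta})}{2}\|\alpha\|^2$ if $\alpha+\beta\in\Delta$, where $p_{\alpha,\beta}$ (resp. $q_{\alpha,\beta}$) is the largest $j\ge0$ with $\beta-j\alpha\in\Delta$ (resp. $\beta+j\alpha\in\Delta$). *)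

(* Defs.v *)
From HB Require Import structures.
From mathcomp Require Import all_boot all_order all_algebra.
From mathcomp Require Import all_classical all_reals all_analysis.
From mathcomp Require Export complex.

Set Implicit Arguments.
Unset Strict Implicit.
Unset Printing Implicit Defensive.

Import Order.TTheory GRing.Theory Num.Theory.
Import numFieldNormedType.Exports.
Import passmx.

Local Open Scope classical_set_scope.
Local Open Scope ring_scope.

HB.mixin Record Vector_isLieAlgebra (K : fieldType) (g : Type)
    of Vector K g := {
  lie : g -> g -> g;
  lieDl : forall x y z, lie (x + y) z = lie x z + lie y z;
  lieZl : forall (a : K) x y, lie (a *: x) y = a *: lie x y;
  lieDr : forall x y z, lie x (y + z) = lie x y + lie x z;
  lieZr : forall (a : K) x y, lie x (a *: y) = a *: lie x y;
  liexx : forall x, lie x x = 0;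
  lie_jacobi : forall x y z,
    lie x (lie y z) + lie y (lie z x) + lie z (lie x y) = 0
}.

#[short(type="lieAlgType")]
HB.structure Definition LieAlgebra (K : fieldType) :=
  {g of Vector_isLieAlgebra K g & Vector K g}.

(* The least subspace containing S (see vspanP). *)
Definition vspan (K : fieldType) (M : vectType K) (S : set M) : {vspace M} :=
  xget 0%VS [set V : {vspace M} | (forall x, S x -> x \in V) /\
    (forall U : {vspace M}, (forall x, S x -> x \in U) -> (V <= U)%VS)].

Lemma vspanP (K : fieldType) (M : vectType K) (S : set M) :
  (forall x, S x -> x \in vspan S) /\
  (forall U : {vspace M}, (forall x, S x -> x \in U) -> (vspan S <= U)%VS).
Proof.
rewrite /vspan; set P := (P in xget _ P); apply: (@xgetPex _ _ P).
pose Q k := `[< exists2 V : {vspace M}, \dim V = k & forall x, S x -> x \in V >].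
have exQ : exists k, Q k.
  by exists (\dim {:M}); apply/asboolP; exists fullv => // x _; exact: memvf.
case: (ex_minnP exQ) => k /asboolP[V dV SV] kmin; exists V; split => // U SU.
have SVU x : S x -> x \in (V :&: U)%VS.
  by move=> Sx; rewrite memv_cap SV ?SU.
have /kmin le_k : Q (\dim (V :&: U)) by apply/asboolP; exists (V :&: U)%VS.
have /eqP <- : (V :&: U == V)%VS by rewrite eqEdim capvSl dV.
exact: capvSr.
Qed.

Section LieBasics.
Variables (K : fieldType) (g : lieAlgType K).
Implicit Types U V I : {vspace g}.

Lemma lie_is_linear (x : g) : linear (lie x).
Proof. by move=> a y z; rewrite lieDr lieZr. Qed.

HB.instance Definition _ (x : g) :=
  GRing.isLinear.Build K g g _ (lie x) (lie_is_linear x).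

Definition ad (x : g) : 'End(g) := linfun (lie x).

Lemma adE (x y : g) : ad x y = lie x y.
Proof. exact: lfunE. Qed.

Definition lie_prod U V : {vspace g} :=
  vspan [set z | exists x y, [/\ x \in U, y \in V & z = lie x y]].

Definition subalgebra U := (lie_prod U U <= U)%VS.

Definition ideal I := (lie_prod fullv I <= I)%VS.

Definition simple_lie :=
  lie_prod fullv fullv <> 0%VS /\
  (forall I, ideal I -> I = 0%VS \/ I = fullv).

Definition solvable_lie U :=
  exists k, iter k (fun V => lie_prod V V) U = 0%VS.

Definition borel_subalgebra U :=
  [/\ subalgebra U, solvable_lie U &
      forall V, subalgebra V -> solvable_lie V -> (U <= V)%VS -> V = U].

Definition diagonalizable (f : 'End(g)) :=
  exists2 e : seq g, basis_of fullv e &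
    forall x, x \in e -> exists c : K, f x = c *: x.

(* Cartan subalgebra of a semisimple Lie algebra: a maximal abelian subalgebra
   all of whose elements are ad-diagonalizable. *)
Definition cartan_subalgebra U :=
  [/\ forall x y, x \in U -> y \in U -> lie x y = 0,
      forall x, (forall y, y \in U -> lie y x = 0) -> x \in U &
      forall x, x \in U -> diagonalizable (ad x)].

Definition killing (x y : g) : K :=
  \sum_(i < \dim (fullv : {vspace g}))
    coord (vbasis fullv) i (lie x (lie y (vbasis fullv)`_i)).

(* g (x) g, written in coordinates with respect to [vbasis fullv]: matrices
   act on row vectors, and x (x) y is (row of x)^T *m (row of y). *)
Definition tensor_sq : vectType K := 'M[K]_(\dim (fullv : {vspace g})).

Definition tensor (x y : g) : tensor_sq :=
  (rVof (vbasis fullv) x)^T *m rVof (vbasis fullv) y.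

Definition tensor_map (f1 f2 : 'End(g)) (t : tensor_sq) : tensor_sq :=
  (mxof (vbasis fullv) (vbasis fullv) f1)^T *m t
    *m mxof (vbasis fullv) (vbasis fullv) f2.

Definition tensor_act (x : g) (t : tensor_sq) : tensor_sq :=
  tensor_map (ad x) \1%VF t + tensor_map \1%VF (ad x) t.

Definition tensor_space U V : {vspace tensor_sq} :=
  vspan [set t | exists x y, [/\ x \in U, y \in V & t = tensor x y]].

End LieBasics.

Section Roots.
Variables (K : fieldType) (g : lieAlgType K) (h : {vspace g}).

Definition weight := 'Hom(subvs_of h, K^o).

Implicit Types a b nu : weight.

Definition weight_vector a (x : g) :=
  forall H : subvs_of h, lie (vsval H) x = (a H : K) *: x.

Definition root_space a : {vspace g} := vspan (weight_vector a).

Definition is_root a := a <> 0 /\ root_space a <> 0%VS.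

Definition roots_of (W : {vspace g}) a := is_root a /\ (root_space a <= W)%VS.

Definition roots_of_at nu (W : {vspace g}) a :=
  roots_of W a /\ is_root (nu - a).

(* The element of h that represents a through the Killing form. *)
Definition weight_dual a : subvs_of h :=
  xget 0 [set t | forall H : subvs_of h, killing (vsval t) (vsval H) = a H].

Definition weight_form a b : K :=
  killing (vsval (weight_dual a)) (vsval (weight_dual b)).

(* The largest j >= 0 with b + j a a root. *)
Definition string_length a b : nat :=
  xget 0%N [set j | is_root (b + a *+ j) /\
                    forall k, is_root (b + a *+ k) -> (k <= j)%N].

Section SimpleRoots.
Variables (n : nat) (Pi : 'I_n -> weight) (q : 'I_n).

Definition nonneg_comb a := exists c : 'I_n -> nat, a = \sum_i Pi i *+ c i.

Definition positive_root a := is_root a /\ nonneg_comb a.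

Definition simple_system :=
  [/\ forall i, is_root (Pi i),
      free [seq Pi i | i : 'I_n] &
      forall a, is_root a -> nonneg_comb a \/ nonneg_comb (- a)].

Definition root_coef a (k : int) :=
  exists2 c : 'I_n -> int, a = \sum_i Pi i *~ c i & c q = k.

Definition levi_root a :=
  is_root a /\ a \in <<[seq Pi i | i <- enum 'I_n & i != q]>>%VS.

Definition sum_root_spaces (P : weight -> Prop) : {vspace g} :=
  vspan [set x | exists2 a, P a & x \in root_space a].

Definition levi : {vspace g} := (h + sum_root_spaces levi_root)%VS.

Definition nilrad : {vspace g} :=
  sum_root_spaces (fun a => positive_root a /\ ~ levi_root a).

Definition graded_piece (k : int) : {vspace g} :=
  sum_root_spaces (fun a => is_root a /\ root_coef a k).

Definition g_one : {vspace g} := graded_piece 1.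

Definition z_nilrad : {vspace g} := graded_piece 2.

Definition quasi_heisenberg :=
  lie_prod nilrad (lie_prod nilrad nilrad) = 0%VS /\
  (1 < \dim (lie_prod nilrad nilrad))%N.

(* nu is the highest weight of the l-stable subspace W of M, with respect to
   h and the positive roots of l; [act] is the action of g on M. *)
Definition highest_weight (M : vectType K) (act : g -> M -> M)
    (W : {vspace M}) nu :=
  exists w, [/\ w \in W, w != 0,
    forall H : subvs_of h, act (vsval H) w = (nu H : K) *: w &
    forall a x, positive_root a -> roots_of levi a -> x \in root_space a ->
      act x w = 0].

End SimpleRoots.

(* p_(a,b) is [string_length (- a) b] and q_(a,b) is [string_length a b]. *)
Record normalized_root_vectors (X : weight -> g) (Hr : weight -> subvs_of h)
    (N : weight -> weight -> K) : Prop := NormalizedRootVectors {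
  nrv_mem : forall a, is_root a -> X a \in root_space a;
  nrv_opp : forall a, is_root a -> lie (X a) (X (- a)) = vsval (Hr a);
  nrv_killing : forall a, is_root a -> killing (X a) (X (- a)) = 1;
  nrv_coroot : forall a b, is_root a -> is_root b ->
    b (Hr a) = weight_form a b;
  nrv_add : forall a b, is_root a -> is_root b -> is_root (a + b) ->
    lie (X a) (X b) = N a b *: X (a + b);
  nrv_nonroot : forall a b, is_root a -> is_root b -> ~ is_root (a + b) ->
    a + b <> 0 -> N a b = 0;
  nrv_cyclic : forall a b c, is_root a -> is_root b -> is_root c ->
    a + b + c = 0 -> N a b = N b c /\ N b c = N c a;
  nrv_prod : forall a b, is_root a -> is_root b -> is_root (a + b) ->
    N a b * N (- a) (- b) =
      - ((string_length a b * (1 + string_length (- a) b))%N%:R / 2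
         * weight_form a a)
}.

End Roots.

Section Complex.
Variables (R : realType) (g : lieAlgType R[i]) (h : {vspace g}).

(* E = exp(ad x), as the pointwise (and coordinatewise) sum of the series. *)
Definition is_exp_ad (x : g) (E : 'End(g)) :=
  forall (y : g) (i : 'I_(\dim (fullv : {vspace g}))),
    (fun m : nat => (coord (vbasis fullv) i
       (\sum_(k < m) (k`!%:R^-1 : R[i]) *: iter k (lie x) y) : R[i]^o)) @ \oo -->
    (coord (vbasis fullv) i (E y) : R[i]^o).

(* The image under Ad of the connected subgroup with Lie algebra U. *)
Inductive Ad_group (U : {vspace g}) : 'End(g) -> Prop :=
| Ad_one : Ad_group U \1%VF
| Ad_mul x E F : x \in U -> is_exp_ad x E -> Ad_group U F ->
    Ad_group U (E \o F)%VF.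

Definition Ad_stable (U : {vspace g}) (W : {vspace tensor_sq g}) :=
  forall E t, Ad_group U E -> t \in W -> tensor_map E E t \in W.

Definition Ad_irreducible (U : {vspace g}) (W : {vspace tensor_sq g}) :=
  [/\ W <> 0%VS, Ad_stable U W &
      forall W', (W' <= W)%VS -> Ad_stable U W' -> W' = 0%VS \/ W' = W].

(* The partial order of R[i] compares numbers with real difference. *)
Definition long_root (a : weight h) :=
  is_root a /\ forall b : weight h, is_root b -> weight_form b b <= weight_form a a.

Section Constituents.
Variables (n : nat) (Pi : 'I_n -> weight h) (q : 'I_n).

Definition constituent (V : {vspace tensor_sq g}) (nu : weight h) :=
  [/\ (V <= tensor_space (levi Pi q) (z_nilrad Pi q))%VS,
      Ad_irreducible (levi Pi q) V &
      highest_weight Pi q (@tensor_act _ g) V nu].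

Definition special_constituent (mu gam : weight h)
    (V : {vspace tensor_sq g}) (nu : weight h) :=
  [/\ constituent V nu, nu <> gam &
      exists2 eps, roots_of (g_one Pi q) eps & nu = mu + eps].

Definition type_1a (mu eps : weight h) :=
  [/\ ~ is_root (mu + eps), eps <> mu, long_root mu & long_root eps].

End Constituents.
End Complex.

Inductive lie_type : Type :=
| Btype of nat | Ctype of nat | Dtype of nat
| E6type | E7type | E8type | F4type.

Definition lie_rank (T : lie_type) : nat :=
  match T with
  | Btype n | Ctype n | Dtype n => n
  | E6type => 6 | E7type => 7 | E8type => 8 | F4type => 4
  end%N.

(* Dynkin diagrams in Bourbaki's numbering (nodes 1, ..., rank). *)
Definition dynkin_edge (T : lie_type) (i j : nat) : bool :=
  let edge a b := ((i == a) && (j == b)) || ((i == b) && (j == a)) in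
  let chain := (i.+1 == j) || (j.+1 == i) in
  let E := [|| edge 1 3, edge 2 4 | [&& chain, 3 <= i & 3 <= j]]%N in
  match T with
  | Btype _ | Ctype _ | F4type => chain
  | Dtype n => [|| [&& chain, i < n & j < n] | edge (n - 2) n]%N
  | E6type | E7type | E8type => E
  end.

(* Endpoints (longer root, shorter root) of the double bond. *)
Definition double_bond (T : lie_type) (i j : nat) : bool :=
  match T with
  | Btype n => (i == n.-1) && (j == n)
  | Ctype n => (i == n) && (j == n.-1)
  | F4type => (i == 2) && (j == 3)
  | _ => false
  end%N.

(* The entry 2 <alpha_i, alpha_j> / <alpha_j, alpha_j>. *)
Definition cartan_entry (T : lie_type) (i j : nat) : int :=
  if i == j then 2
  else if ~~ dynkin_edge T i j then 0
  else if double_bond T i j then - 2 else - 1.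

Definition listed_type (T : lie_type) (i : nat) : bool :=
  match T with
  | Btype n => 3 <= i <= n
  | Ctype n => 2 <= i <= n - 1
  | Dtype n => 3 <= i <= n - 3
  | E6type => (i == 3) || (i == 5)
  | E7type => (i == 2) || (i == 6)
  | E8type => i == 1
  | F4type => i == 4
  end%N.

(* Index i : 'I_(lie_rank T) stands for the simple root alpha_(i+1). *)
Definition has_type (K : fieldType) (g : lieAlgType K) (h : {vspace g})
    (T : lie_type) (Pi : 'I_(lie_rank T) -> weight h) :=
  forall i j : 'I_(lie_rank T),
    2 * weight_form (Pi i) (Pi j) / weight_form (Pi j) (Pi j)
      = (cartan_entry T i.+1 j.+1)%:~R.

(* Main.v *)
From HB Require Import structures.
Require Import Defs.
From mathcomp Require Import all_boot all_order all_algebra.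
From mathcomp Require Import all_classical all_reals all_analysis.
From mathcomp Require Import ring lra zify.

(* Root vectors normalized by the Killing form already determine the root
   system: evaluating [[X_a, X_-a], X_b] with the given products
   N_{a,b} N_{-a,-b} shows that 2<a,b>/<a,a> is an integer and that a + b is a
   root when <a,b> < 0, and the trace formula <v,v> = sum_i <w_i,v>^2 then makes
   the form positive definite on the real span of the roots.

   Put nu = mu + eps and let L be the squared length of a long root. Since
   gamma_j and nu - gamma_j are roots, mu and eps are orthogonal, and every root
   x other than mu and eps such that nu - x is a root satisfies
   <x,mu> = <x,eps> = L/2; it is either long or equal to nu/2. Jacobi gives
     N_{mu,-alpha} N_{mu-alpha,alpha-gamma} N_{alpha,-gamma}
       = (L/2) N_{mu,-gamma}
   and the same identity for (eps, theta(alpha), theta(gamma)); the product of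
   the two, with N_{mu-alpha,alpha-gamma} N_{alpha-mu,gamma-alpha} = - L/2, is
   the claim up to the value of L. Finally ||alpha_q||^2 = L because a long root
   with alpha_q-coefficient 1 can be moved to alpha_q by reflections in the
   other simple roots. *)

Set Implicit Arguments.
Unset Strict Implicit.
Unset Printing Implicit Defensive.

Import Order.TTheory GRing.Theory Num.Theory.
Import passmx.
Local Open Scope ring_scope.
Local Open Scope complex_scope.

(** * Killing form *)

Section Trace.
Variables (K : fieldType) (V : vectType K).
Let n : nat := \dim (fullv : {vspace V}).
Implicit Types (e : n.-tuple V) (f : V -> V).

(** Taking a bare function instead of an endomorphism makes the sum in [killing] an instance by
    conversion. *)
Definition ltrace e f : K := \sum_(i < n) coord e i (f e`_i).

Lemma ltraceMC e (f1 f2 : {linear V -> V}) : basis_of fullv e ->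
  ltrace e (fun x => f1 (f2 x)) = ltrace e (fun x => f2 (f1 x)).
Proof.
move=> eb.
have E (k1 k2 : {linear V -> V}) : ltrace e (fun x => k1 (k2 x)) =
   \sum_(i < n) \sum_(j < n) coord e j (k2 e`_i) * coord e i (k1 e`_j).
  apply: eq_bigr => i _; rewrite {1}(coord_basis eb (memvf (k2 _))).
  by rewrite !linear_sum; apply: eq_bigr => j _; rewrite !linearZ.
rewrite !E exchange_big; apply: eq_bigr => i _; apply: eq_bigr => j _.
exact: mulrC.
Qed.

(** Expanding the vectors of [e] along [e'], or the images of the vectors of [e'] along [e], gives
    the same double sum. *)
Lemma ltrace_basis e e' (f : {linear V -> V}) : basis_of fullv e ->
  basis_of fullv e' -> ltrace e f = ltrace e' f.
Proof.
move=> eb eb'.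
have -> : ltrace e f =
    \sum_(i < n) \sum_(j < n) coord e' j e`_i * coord e i (f e'`_j).
  apply: eq_bigr => i _; rewrite {1}(coord_basis eb' (memvf e`_i)).
  by rewrite !linear_sum; apply: eq_bigr => j _; rewrite !linearZ.
rewrite exchange_big; apply: eq_bigr => j _.
rewrite {2}(coord_basis eb (memvf (f e'`_j))) linear_sum.
by apply: eq_bigr => i _; rewrite linearZ mulrC.
Qed.

End Trace.

Section Killing.
Variables (K : fieldType) (g : lieAlgType K).
Implicit Types x y z : g.

Lemma lieC x y : lie x y = - lie y x.
Proof.
apply/eqP; rewrite -addr_eq0; apply/eqP.
by have := liexx (x + y); rewrite lieDl !lieDr !liexx add0r addr0.
Qed.

Lemma lie0l x : lie (0 : g) x = 0.
Proof. by have := lieZl (0 : K) (0 : g) x; rewrite !scale0r. Qed.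

Lemma lie_lie x y z : lie (lie x y) z = lie x (lie y z) - lie y (lie x z).
Proof.
have := lie_jacobi x y z; rewrite (lieC z (lie x y)) (lieC z x) linearN /=.
by move/eqP; rewrite subr_eq0 => /eqP.
Qed.

Lemma killing_basis (e : (\dim (fullv : {vspace g})).-tuple g) x y :
  basis_of fullv e -> killing x y = \sum_i coord e i (lie x (lie y e`_i)).
Proof.
move=> eb; exact: (ltrace_basis (lie x \o lie y) (vbasisP _) eb).
Qed.

Lemma killingC x y : killing x y = killing y x.
Proof. exact: (ltraceMC (lie x) (lie y) (vbasisP _)). Qed.

Lemma killingDl x y z : killing (x + y) z = killing x z + killing y z.
Proof.
by rewrite -big_split; apply: eq_bigr => i _; rewrite lieDl linearD.
Qed.

Lemma killingZl a x z : killing (a *: x) z = a * killing x z.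
Proof. by rewrite mulr_sumr; apply: eq_bigr => i _; rewrite lieZl linearZ. Qed.

Lemma killingDr x y z : killing z (x + y) = killing z x + killing z y.
Proof. by rewrite !(killingC z) killingDl. Qed.

Lemma killingZr a x z : killing z (a *: x) = a * killing z x.
Proof. by rewrite !(killingC z) killingZl. Qed.

(** With ad of a bracket written as a commutator, both sides contain the trace of ad x ad y ad z,
    and the remaining traces agree by cyclicity. *)
Lemma killing_lie x y z : killing (lie x y) z = killing x (lie y z).
Proof.
pose v := vbasis (fullv : {vspace g}).
have cyc : \sum_i coord v i (lie y (lie x (lie z v`_i)))
         = \sum_i coord v i (lie x (lie z (lie y v`_i))).
  exact: (ltraceMC (lie y) (lie x \o lie z) (vbasisP _)).
rewrite /killing -/v.
under eq_bigr => i _ do rewrite lie_lie linearB /=.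
under [RHS]eq_bigr => i _ do rewrite lie_lie !linearB /=.
by rewrite !sumrB cyc.
Qed.

End Killing.

(** * A basis of weight vectors *)

Section WeightBasis.
Variables (K : fieldType) (g : lieAlgType K) (h : {vspace g}).
Hypothesis hC : cartan_subalgebra h.
Let n : nat := \dim (fullv : {vspace g}).

(** Reduces to simultaneous diagonalization of commuting matrices; the rows of the matrix [P]
    obtained are the coordinates of the common eigenvectors. *)
Lemma codiag_basis (fs : seq 'End(g)) :
  {in fs &, forall f1 f2 : 'End(g), forall x, f1 (f2 x) = f2 (f1 x)} ->
  {in fs, forall f : 'End(g), Defs.diagonalizable f} ->
  exists2 e : n.-tuple g, basis_of fullv e &
    {in fs, forall f : 'End(g), forall i : 'I_n,
       exists c : K, f e`_i = c *: e`_i}.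
Proof.
move=> fC fD; set v := vbasis (fullv : {vspace g}).
have vb : basis_of fullv v := vbasisP _.
pose As := [seq mxof v v f | f <- fs].
have [|P Pu /allP PD] := (proj1 (codiagonalizableP As)).
  split.
    move=> _ _ /mapP[f ff ->] /mapP[f' ff' ->]; rewrite /comm_mx.
    apply/row_matrixP => i; rewrite !rowE !mulmxA !mul_mxof !(rVofK vb).
    by congr (rVof _ _); exact: fC.
  move=> _ /mapP[f /fD[e eb ef] ->].
  have sz : size e == n.
    by apply/eqP/esym; exact: (size_basis (X := in_tuple e) eb).
  pose P := \matrix_(i < n) rVof v e`_i.
  have Pu : P \in unitmx.
    rewrite -row_free_unit -kermx_eq0; apply/rowV0P => u /sub_kermxP uP.
    have fe := basis_free eb.
    have /freeP fr : free (Tuple sz) by [].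
    apply/rowP => i; rewrite [RHS]mxE; apply: (fr (fun i => u 0 i)) => /=.
    move: uP; rewrite mulmx_sum_row => uP.
    apply: (can_inj (rVofK vb)); rewrite linear0 -[RHS]uP linear_sum.
    by apply: eq_bigr => j _; rewrite linearZ rowK.
  exists P => //; apply/diagonalizable_forPex.
  have /choice [c cE] : forall i : 'I_n, exists c : K, f e`_i = c *: e`_i.
    by move=> i; apply: ef; rewrite mem_nth // (eqP sz).
  exists (\row_i c i); apply/simmxP => //; apply/row_matrixP => i.
  rewrite row_mul rowK mul_mxof (rVofK vb) cE linearZ /= row_mul row_diag_mx.
  by rewrite -scalemxAl -rowE rowK mxE.
pose e := [tuple vecof v (row i P) | i < n].
have eE (i : 'I_n) : e`_i = vecof v (row i P) by rewrite -tnth_nth tnth_mktuple.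
exists e.
  rewrite basisEfree subvf size_tuple leqnn !andbT; apply/freeP => k.
  under eq_bigr => i _ do rewrite eE -linearZ /=.
  rewrite -linear_sum => /eqP; rewrite vecof_eq0 // => /eqP kP.
  have : (\row_i k i) *m P = 0.
    by rewrite mulmx_sum_row -[RHS]kP; apply: eq_bigr => i _; rewrite mxE.
  move/(congr1 (mulmx^~ (invmx P))); rewrite mulmxK // mul0mx => /rowP k0 i.
  by have := k0 i; rewrite !mxE.
move=> f ff i; have := PD _ (map_f (mxof v v) ff).
move=> /diagonalizable_forPex[D /(simmxP Pu) /(congr1 (row i))].
rewrite !row_mul row_diag_mx -scalemxAl -rowE mul_mxof => PE.
exists (D 0 i); rewrite eE; apply: (can_inj (rVofK vb)).
by rewrite PE linearZ /= vecofK.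
Qed.

(** It suffices to diagonalize together the finitely many ad x with [x] in a basis of [h]: their
    common eigenvectors are eigenvectors for all of [h]. *)
Lemma weight_basis : exists (e : n.-tuple g) (w : 'I_n -> weight h),
  basis_of fullv e /\ forall i : 'I_n, weight_vector (w i) e`_i.
Proof.
case: hC => hab _ hD.
have [||e eb eE] := @codiag_basis [seq ad x | x <- vbasis h].
- move=> _ _ /mapP[x xh ->] /mapP[y yh ->] z; rewrite !adE.
  by apply/eqP; rewrite -subr_eq0 -lie_lie (hab x y) ?vbasis_mem // lie0l.
- by move=> _ /mapP[x xh ->]; apply: hD; rewrite vbasis_mem.
have ex (i : 'I_n) : exists w : weight h, weight_vector w e`_i.
  have eig (x : g) : x \in h -> lie x e`_i \in <[e`_i]>%VS.
    move=> xh; rewrite (coord_vbasis xh) lieC rpredN linear_sum.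
    apply: rpred_sum => j _.
    rewrite linearZ /=; apply: memvZ; rewrite lieC rpredN.
    have jh : (vbasis h)`_j \in vbasis h by rewrite mem_nth ?size_tuple.
    have [c] := eE _ (map_f _ jh) i.
    by rewrite adE => ->; apply: memvZ; exact: memv_line.
  (* Reading the eigenvalue off as the [i]-th coordinate makes its linearity in [H] immediate. *)
  pose w (H : subvs_of h) : K^o := coord e i (lie (vsval H) e`_i).
  have wl : linear w.
    by move=> a H H'; rewrite /w linearP lieDl lieZl linearP.
  pose wL := HB.pack_for {linear subvs_of h -> K^o} w
     (GRing.isLinear.Build _ _ _ _ w wl).
  exists (linfun wL) => H; rewrite lfunE /= /w.
  have /vlineP[c ->] := eig _ (subvsP H).
  by rewrite linearZ /= coord_free ?(basis_free eb) // eqxx mulr1.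
by have [w wE] := choice ex; exists e, w.
Qed.

End WeightBasis.

(** * Weight spaces *)

Section Weights.
Variables (K : fieldType) (g : lieAlgType K) (h : {vspace g}).
Implicit Types (a b : weight h) (x y : g).

(** The weight vectors already form a subspace, the intersection of the kernels of ad H - a(H), so
    the span adds nothing. *)
Lemma root_spaceP a x : x \in root_space a <-> weight_vector a x.
Proof.
split; last exact: (vspanP _).1.
move=> xa H; apply/eqP; rewrite -subr_eq0.
have sub : (root_space a <= lker (ad (vsval H) - (a H : K) *: \1%VF))%VS.
  apply: (vspanP _).2 => y ya.
  rewrite memv_ker add_lfunE opp_lfunE scale_lfunE id_lfunE adE.
  by rewrite ya subrr.
have := subvP sub _ xa.
by rewrite memv_ker add_lfunE opp_lfunE scale_lfunE id_lfunE adE.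
Qed.

Lemma root_space_neq0P a :
  root_space a <> 0%VS <-> exists2 x, weight_vector a x & x <> 0.
Proof.
split=> [/eqP n0|[x /root_spaceP xa x0] a0]; last first.
  by apply: x0; apply/eqP; move: xa; rewrite a0 memv0.
exists (vpick (root_space a)); first exact/root_spaceP/memv_pick.
by apply/eqP; rewrite vpick0.
Qed.

Lemma weight_vectorD a b x y : weight_vector a x -> weight_vector b y ->
  weight_vector (a + b) (lie x y).
Proof.
move=> xa yb H; rewrite lfunE /= scalerDl.
have := lie_lie (vsval H) x y; rewrite xa yb linearZ lieZl /= => /eqP.
by rewrite -subr_eq opprK addrC => /eqP <-; rewrite addrC.
Qed.

Variables (e : (\dim (fullv : {vspace g})).-tuple g)
  (w : 'I_(\dim (fullv : {vspace g})) -> weight h).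
Hypotheses (eb : basis_of fullv e) (we : forall i, weight_vector (w i) e`_i).

Lemma coord_weight (H : subvs_of h) x i :
  coord e i (lie (vsval H) x) = (w i H : K) * coord e i x.
Proof.
rewrite {1}(coord_basis eb (memvf x)) !linear_sum (bigD1 i) //= big1 => [|j ji].
  rewrite !linearZ /= we linearZ /= coord_free ?(basis_free eb) //.
  by rewrite eqxx mulr1 addr0 mulrC.
rewrite !linearZ /= we linearZ /= coord_free ?(basis_free eb) //.
by rewrite (negPf ji) !mulr0.
Qed.

(** Bracketing with [H] multiplies the [i]-th coordinate both by w_i(H) and by a(H). *)
Lemma weight_vector_coord a x i :
  weight_vector a x -> coord e i x <> 0 -> w i = a.
Proof.
move=> xa xi; apply/lfunP => H; have := coord_weight H x i.
by rewrite xa linearZ /= => /(mulIf (introN eqP xi)).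
Qed.

Lemma coord_neq0 x : x <> 0 -> exists i, coord e i x <> 0.
Proof.
move=> x0; apply: contrapT => /forallNP nx; apply: x0.
rewrite (coord_basis eb (memvf x)) big1 // => i _.
by rewrite (contrapT (nx i)) scale0r.
Qed.

Lemma sum_root_spaces_coord (P : weight h -> Prop) x i :
  x \in sum_root_spaces P -> coord e i x <> 0 -> P (w i).
Proof.
move=> xP xi; apply: contrapT => nP; apply: xi.
have sub : (sum_root_spaces P <= lker (linfun (coord e i : g -> K^o)))%VS.
  apply: (vspanP _).2 => y [a Pa /root_spaceP ya]; rewrite memv_ker lfunE /=.
  apply/eqP; apply: contrapT => /(weight_vector_coord ya) E.
  by rewrite E in nP.
by have := subvP sub _ xP; rewrite memv_ker lfunE => /eqP.
Qed.

Lemma sum_root_spaces_weight (P : weight h -> Prop) a x :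
  x \in sum_root_spaces P -> weight_vector a x -> x <> 0 -> P a.
Proof.
move=> xP xa /coord_neq0[i xi].
by rewrite -(weight_vector_coord xa xi); exact: sum_root_spaces_coord xi.
Qed.

Lemma roots_of_sum_root_spaces (P : weight h -> Prop) a :
  roots_of (sum_root_spaces P) a -> P a.
Proof.
case=> -[_ /root_space_neq0P[x xa x0]] /subvP sub.
by apply: (sum_root_spaces_weight _ xa x0); exact/sub/root_spaceP.
Qed.

Lemma basis_neq0 (i : 'I_(\dim (fullv : {vspace g}))) : e`_i <> 0.
Proof.
by apply/eqP/(free_not0 (basis_free eb)); rewrite mem_nth ?size_tuple.
Qed.

Lemma basis_weight_root i : w i <> 0 -> is_root (w i).
Proof.
by split=> //; apply/root_space_neq0P; exists e`_i => //; exact: basis_neq0.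
Qed.

Lemma root_basis_weight a : is_root a -> exists i, w i = a.
Proof.
case=> _ /root_space_neq0P[x xa /coord_neq0[i xi]].
by exists i; exact: weight_vector_coord xi.
Qed.

Lemma killing_weights (H H' : subvs_of h) :
  killing (vsval H) (vsval H') = \sum_i (w i H : K) * (w i H' : K).
Proof.
rewrite (killing_basis _ _ eb); apply: eq_bigr => i _.
rewrite we linearZ /= we !linearZ /= coord_free ?(basis_free eb) //.
by rewrite eqxx mulr1 mulrC.
Qed.

Lemma killing_weight_orth a b x y : weight_vector a x -> weight_vector b y ->
  a + b <> 0 -> killing x y = 0.
Proof.
move=> xa yb ab0; apply: contrapT => k0; apply: ab0; apply/lfunP => H.
have := killing_lie x (vsval H) y.
rewrite lieC xa -scaleNr killingZl yb killingZr => /(mulIf (introN eqP k0)) E.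
by rewrite !lfunE /= -E subrr.
Qed.

(** If -a were not among the weights of the basis, [x] would be orthogonal to every basis vector,
    hence to [y]. The vector [y] is arbitrary because X_{-a} is only known to be a root vector once
    -a is a root. *)
Lemma killing_root_opp a x y : weight_vector a x -> killing x y <> 0 ->
  root_space (- a) <> 0%VS.
Proof.
move=> xa xy; have [i wi] : exists i, w i = - a.
  apply: contrapT => /forallNP nw; apply: xy.
  rewrite killingC (coord_basis eb (memvf y)).
  elim/big_ind: _ => [|u v u0 v0|i _].
  - by rewrite -(scale0r x) killingZl mul0r.
  - by rewrite killingDl u0 v0 addr0.
  - rewrite killingZl killingC (killing_weight_orth xa (@we i)) ?mulr0 // => E.
    by apply: (nw i); apply/eqP; rewrite -addr_eq0 addrC E.
by apply/root_space_neq0P; exists e`_i; [rewrite -wi|exact: basis_neq0].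
Qed.

(* A Cartan element annihilated by all roots is central. *)
Lemma roots_separate (H : subvs_of h) : simple_lie g ->
  (forall a, is_root a -> (a H : K) = 0) -> H = 0.
Proof.
case=> nab sim aH.
have HC x : lie (vsval H) x = 0.
  rewrite (coord_basis eb (memvf x)) linear_sum big1 // => i _.
  rewrite linearZ /= we; have [->|/eqP wi] := eqVneq (w i) 0.
    by rewrite zero_lfunE scale0r scaler0.
  by rewrite aH ?scale0r ?scaler0 //; exact: basis_weight_root.
have idl : ideal <[vsval H]>.
  apply: (vspanP _).2 => _ [x [_ [_ /vlineP[c ->] ->]]].
  by rewrite linearZ /= lieC HC oppr0 scaler0 mem0v.
case: (sim _ idl) => [H0|Hf].
  by apply: val_inj; apply/eqP; rewrite -memv0 -H0 memv_line.
case: nab; apply/eqP; rewrite -subv0; apply: (vspanP _).2 => _ [x [y [_ _ ->]]].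
have : x \in <[vsval H]>%VS by rewrite Hf memvf.
by case/vlineP=> c ->; rewrite lieZl HC scaler0 mem0v.
Qed.

End Weights.

(** * Normalized root vectors *)

Section Normalized.
Variables (K : fieldType) (g : lieAlgType K) (h : {vspace g}).
Variables (e : (\dim (fullv : {vspace g})).-tuple g)
  (w : 'I_(\dim (fullv : {vspace g})) -> weight h).
Hypotheses (eb : basis_of fullv e) (we : forall i, weight_vector (w i) e`_i).
Variables (X : weight h -> g) (Hr : weight h -> subvs_of h)
  (N : weight h -> weight h -> K).
Hypotheses (simg : simple_lie g) (nX : normalized_root_vectors X Hr N).
Implicit Types a b c : weight h.

Lemma nrv_weight a : is_root a -> weight_vector a (X a).
Proof. by move=> ra; exact/root_spaceP/(nrv_mem nX). Qed.

Lemma root_opp a : is_root a -> is_root (- a).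
Proof.
move=> ra; split=> [/eqP|]; first by rewrite oppr_eq0 => /eqP; case: ra.
apply: (killing_root_opp eb we (nrv_weight ra) (y := X (- a))).
by rewrite (nrv_killing nX ra); apply/eqP; exact: oner_neq0.
Qed.

Lemma nrv_neq0 a : is_root a -> X a <> 0.
Proof.
move=> ra X0; have := nrv_killing nX ra; rewrite X0 -(scale0r 0) killingZl mul0r.
by move/esym/eqP; rewrite oner_eq0.
Qed.

Lemma nrv_inj a (k l : K) : is_root a -> k *: X a = l *: X a -> k = l.
Proof.
move=> /nrv_neq0/eqP X0 /eqP; rewrite -subr_eq0 -scalerBl scaler_eq0 (negPf X0).
by rewrite orbF subr_eq0 => /eqP.
Qed.

(** This form also covers the case where a + b is not a root: a nonzero bracket would have weight a
    + b and make it one. *)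
Lemma nrv_lie a b : is_root a -> is_root b -> a + b <> 0 ->
  lie (X a) (X b) = N a b *: X (a + b).
Proof.
move=> ra rb ab0; case: (pselect (is_root (a + b))) => rab.
  exact: (nrv_add nX).
rewrite (nrv_nonroot nX) // scale0r; apply: contrapT => L0; apply: rab.
split=> //; apply/root_space_neq0P; exists (lie (X a) (X b)) => //.
by apply: weight_vectorD; exact: nrv_weight.
Qed.

Lemma nrvC a b : is_root a -> is_root b -> a + b <> 0 -> N b a = - N a b.
Proof.
move=> ra rb ab0; case: (pselect (is_root (a + b))) => rab.
  apply: (nrv_inj rab); rewrite scaleNr -nrv_lie // -lieC nrv_lie //.
    by rewrite addrC.
  by rewrite addrC.
by rewrite !(nrv_nonroot nX) ?oppr0 // addrC.
Qed.

Lemma nrv_root_rep a (H : subvs_of h) : is_root a ->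
  killing (vsval (Hr a)) (vsval H) = a H.
Proof.
move=> ra; rewrite -(nrv_opp nX ra) killing_lie lieC.
rewrite (nrv_weight (root_opp ra)) -scaleNr killingZr (nrv_killing nX ra) mulr1.
by rewrite opp_lfunE opprK.
Qed.

Lemma killing_cartan_nondeg (H : subvs_of h) :
  (forall H' : subvs_of h, killing (vsval H) (vsval H') = 0) -> H = 0.
Proof.
move=> H0; apply: (roots_separate eb we simg) => a ra.
by rewrite -(nrv_root_rep H ra) killingC H0.
Qed.

(** The map from [h] to its dual given by the Killing form is injective by [killing_cartan_nondeg],
    and both spaces have the same dimension. *)
Lemma weight_rep a : exists t : subvs_of h, forall H : subvs_of h,
  killing (vsval t) (vsval H) = a H.
Proof.
pose kr (t H : subvs_of h) : K^o := killing (vsval t) (vsval H).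
have kr_lin t : linear (kr t).
  by move=> c H H'; rewrite /kr linearP killingDr killingZr.
pose krL t := HB.pack_for {linear subvs_of h -> K^o} (kr t)
  (GRing.isLinear.Build _ _ _ _ (kr t) (kr_lin t)).
pose phi t : weight h := linfun (krL t).
have phi_lin : linear phi.
  move=> c t t'; apply/lfunP => H; rewrite add_lfunE scale_lfunE !lfunE /= /kr.
  by rewrite linearP killingDl killingZl.
pose phiL := HB.pack_for {linear subvs_of h -> weight h} phi
  (GRing.isLinear.Build _ _ _ _ phi phi_lin).
pose Phi := linfun phiL.
have ker0 : lker Phi = 0%VS.
  apply/eqP; rewrite -subv0; apply/subvP => t; rewrite memv_ker memv0 lfunE /=.
  move=> /eqP/lfunP t0; apply/eqP/killing_cartan_nondeg => H.
  by have := t0 H; rewrite lfunE zero_lfunE.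
have img : limg Phi = fullv.
  apply/eqP; rewrite eqEdim subvf limg_dim_eq ?ker0 ?capv0 //=.
  by rewrite !dimvf /dim /= muln1.
have /memv_imgP[t _ tE] : a \in limg Phi by rewrite img memvf.
by exists t => H; rewrite tE !lfunE.
Qed.

Lemma weight_dualP a (H : subvs_of h) :
  killing (vsval (weight_dual a)) (vsval H) = a H.
Proof.
rewrite /weight_dual; set P := (P in xget _ P).
have ex : exists t, P t := weight_rep a; exact: (xgetPex 0 ex H).
Qed.

Lemma weight_formE a b : weight_form a b = a (weight_dual b).
Proof. exact: weight_dualP. Qed.

Lemma weight_formC a b : weight_form a b = weight_form b a.
Proof. exact: killingC. Qed.

Lemma weight_formDl a b c :
  weight_form (a + b) c = weight_form a c + weight_form b c.
Proof. by rewrite !weight_formE add_lfunE. Qed.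

Lemma weight_formNl a c : weight_form (- a) c = - weight_form a c.
Proof. by rewrite !weight_formE opp_lfunE. Qed.

Lemma weight_form0l c : weight_form (0 : weight h) c = 0.
Proof. by rewrite weight_formE zero_lfunE. Qed.

(** Trace formula: the elements dual to [a] and [b] act diagonally on the weight basis. *)
Lemma weight_form_sum a b :
  weight_form a b = \sum_i weight_form (w i) a * weight_form (w i) b.
Proof.
rewrite {1}/weight_form (killing_weights eb we).
by apply: eq_bigr => i _; rewrite !weight_formE.
Qed.

Lemma weight_form_nondeg a :
  (forall b, is_root b -> weight_form b a = 0) -> a = 0.
Proof.
move=> a0; apply/lfunP => H; rewrite zero_lfunE -weight_dualP.
have -> : weight_dual a = 0.
  by apply: (roots_separate eb we simg) => b rb; rewrite -weight_formE a0.
by rewrite linear0 -(scale0r 0) killingZl mul0r.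
Qed.

(* Evaluate [[X_a, X_-a], X_b] = <a, b> X_b by the Jacobi identity: the two
   terms are products of structure constants known from [nrv_prod]. *)
Lemma root_string_form a b : (2 : K) != 0 -> is_root a -> is_root b ->
  a + b <> 0 -> b <> a ->
  exists n1 n2 : nat,
  [/\ 2 * weight_form a b = (n1%:R - n2%:R) * weight_form a a,
    is_root (b - a) ->
      n1 = (string_length (- a)%R b * (1 + string_length a b))%N,
    ~ is_root (b - a) -> n1 = 0%N & ~ is_root (a + b) -> n2 = 0%N].
Proof.
move=> two0 ra rb ab0 nba; have rNa := root_opp ra; have rNb := root_opp rb.
have ba0 : - a + b <> 0.
  by move/eqP; rewrite addrC subr_eq0 => /eqP.
set p := string_length (- a) b; set q := string_length a b.
pose u1 := lie (X a) (lie (X (- a)) (X b)).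
pose u2 := lie (X (- a)) (lie (X a) (X b)).
have u1E : exists n1 : nat, [/\ u1 = (n1%:R / 2 * weight_form a a) *: X b,
    is_root (b - a) -> n1 = (p * (1 + q))%N & ~ is_root (b - a) -> n1 = 0%N].
  case: (pselect (is_root (b - a))) => rba; last first.
    exists 0%N; split=> //; rewrite /u1 nrv_lie //.
    rewrite (nrv_nonroot nX) // ?(addrC (- a)) // scale0r.
    by rewrite linear0 !mul0r scale0r.
  exists (p * (1 + q))%N; split=> //.
  have rba' : is_root (- a + b) by rewrite addrC.
  have -> : u1 = (N (- a) b * N a (- a + b)) *: X b.
    rewrite /u1 nrv_lie // linearZ /= nrv_lie // addNKr; first by rewrite scalerA.
    by case: rb.
  (* The triple a, b - a, -b sums to zero, so cyclicity brings the product to the shape of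
     [nrv_prod] for the pair -a, b. *)
  have -> : N a (- a + b) = - N a (- b).
    have [|-> ->] := nrv_cyclic nX ra rba' rNb; first by rewrite addNKr subrr.
    by rewrite nrvC // => /eqP; rewrite subr_eq0 => /eqP E; apply: nba.
  have := nrv_prod nX rNa rb rba'; rewrite opprK mulrN => ->.
  by rewrite opprK weight_formNl weight_formC weight_formNl opprK.
have u2E : exists2 n2 : nat, u2 = (n2%:R / 2 * weight_form a a) *: X b &
    ~ is_root (a + b) -> n2 = 0%N.
  case: (pselect (is_root (a + b))) => rab; last first.
    exists 0%N => //; rewrite /u2 nrv_lie //.
    by rewrite (nrv_nonroot nX) // scale0r linear0 !mul0r scale0r.
  exists (q * (1 + p))%N => //.
  have -> : u2 = (N a b * N (- a) (a + b)) *: X b.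
    rewrite /u2 nrv_lie // linearZ /= nrv_lie // addKr; first by rewrite scalerA.
    by case: rb.
  have -> : N (- a) (a + b) = - N (- a) (- b).
    have [|-> ->] := nrv_cyclic nX rNa rab rNb; first by rewrite addKr subrr.
    by rewrite nrvC // -opprD => /eqP; rewrite oppr_eq0 => /eqP.
  by rewrite mulrN (nrv_prod nX ra rb rab) opprK.
have [n1 [e1 n1r n1n]] := u1E; have [n2 e2 n2n] := u2E.
exists n1, n2; split=> //.
have : u1 - u2 = weight_form a b *: X b.
  by rewrite -lie_lie (nrv_opp nX ra) (nrv_weight rb) (nrv_coroot nX ra rb).
rewrite e1 e2 -scalerBl => /(nrv_inj rb) <-.
by field.
Qed.

End Normalized.

(** * The real form on the roots *)

Section RealForm.
Variables (R : realType) (g : lieAlgType R[i]) (h : {vspace g}).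
Variables (e : (\dim (fullv : {vspace g})).-tuple g)
  (w : 'I_(\dim (fullv : {vspace g})) -> weight h).
Hypotheses (eb : basis_of fullv e) (we : forall i, weight_vector (w i) e`_i).
Variables (X : weight h -> g) (Hr : weight h -> subvs_of h)
  (N : weight h -> weight h -> R[i]).
Hypotheses (simg : simple_lie g) (nX : normalized_root_vectors X Hr N).
Implicit Types a b c v : weight h.

Let two0 : (2 : R[i]) != 0.
Proof. by rewrite pnatr_eq0. Qed.

Let wfN a b : weight_form a (- b) = - weight_form a b.
Proof.
by rewrite weight_formC (weight_formNl eb we simg nX) weight_formC.
Qed.

Let wfD a b c : weight_form a (b + c) = weight_form a b + weight_form a c.
Proof.
by rewrite weight_formC (weight_formDl eb we simg nX) !(weight_formC a).
Qed.

Lemma root_form_int a b : is_root a -> is_root b ->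
  exists m : int, 2 * weight_form a b = m%:~R * weight_form a a.
Proof.
move=> ra rb; case: (eqVneq (a + b) 0) => [ab0|/eqP ab0].
  exists (- 2); have -> : b = - a by apply/eqP; rewrite -addr_eq0 addrC ab0.
  by rewrite wfN mulrN rmorphN mulNr.
case: (eqVneq b a) => [->|/eqP nab]; first by exists 2.
have [n1 [n2 [E _ _ _]]] := root_string_form eb we simg nX two0 ra rb ab0 nab.
by exists (n1%:Z - n2%:Z); rewrite rmorphB /= E.
Qed.

(** By [root_form_int] an isotropic root would be orthogonal to all roots, against nondegeneracy. *)
Lemma root_form_neq0 a : is_root a -> weight_form a a != 0.
Proof.
move=> ra; apply/eqP => a0; case: (ra) => + _; apply.
apply: (weight_form_nondeg eb we simg nX) => b rb.
have [m] := root_form_int ra rb; rewrite a0 mulr0 weight_formC => /eqP.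
by rewrite mulf_eq0 (negPf two0) => /eqP.
Qed.

(* Substituting the integers 2<w_i,a>/<a,a> in <a,a> = sum_i <w_i,a>^2 shows
   that <a,a> is rational. *)
Lemma root_norm_real a : is_root a -> exists r : R, weight_form a a = r%:C.
Proof.
move=> ra.
have /choice [m mE] : forall i, exists m : int,
    2 * weight_form (w i) a = m%:~R * weight_form a a.
  move=> i; have [->|/eqP wi] := eqVneq (w i) 0.
    by exists 0; rewrite (weight_form0l eb we simg nX) mulr0 mul0r.
  by rewrite weight_formC; exact: root_form_int ra (basis_weight_root eb we wi).
pose M : int := \sum_i m i ^+ 2.
(* One factor <a,a> is cancelled in 4<a,a> = sum_i (2<w_i,a>)^2 = M<a,a>^2. *)
have E : 4 = M%:~R * weight_form a a.
  apply: (mulIf (root_form_neq0 ra)); rewrite -mulrA -expr2.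
  rewrite {1}(weight_form_sum eb we simg nX) mulr_sumr rmorph_sum mulr_suml.
  by apply: eq_bigr => i _; rewrite rmorphXn /= -exprMn -mE; ring.
exists (4 / M%:~R); rewrite rmorphM fmorphV !rmorph_nat rmorph_int E.
rewrite mulrAC divff ?mul1r //.
by apply/eqP => M0; move/eqP: E; rewrite M0 mul0r pnatr_eq0.
Qed.

(** Taking the real part gives a form that is additive on all weights and agrees with [weight_form]
    on pairs of roots. *)
Definition rform a b : R := complex.Re (weight_form a b).

Lemma rformE a b : is_root a -> is_root b -> weight_form a b = (rform a b)%:C.
Proof.
move=> ra rb; have [m E] := root_form_int ra rb; have [r rE] := root_norm_real ra.
suff [s sE] : exists s : R, weight_form a b = s%:C by rewrite /rform sE.
exists (m%:~R * r / 2); rewrite !rmorphM fmorphV rmorph_int rmorph_nat /= -rE -E.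
by rewrite mulrAC divff // mul1r.
Qed.

Lemma rformC a b : rform a b = rform b a.
Proof. by rewrite /rform weight_formC. Qed.

Lemma rformDl a b c : rform (a + b) c = rform a c + rform b c.
Proof. by rewrite /rform (weight_formDl eb we simg nX) raddfD. Qed.

Lemma rformNl a c : rform (- a) c = - rform a c.
Proof. by rewrite /rform (weight_formNl eb we simg nX) raddfN. Qed.

Lemma rform_int a b : is_root a -> is_root b ->
  exists m : int, 2 * rform a b = m%:~R * rform a a.
Proof.
move=> ra rb; have [m E] := root_form_int ra rb; exists m.
apply: (@complexI R); rewrite !rmorphM rmorph_nat rmorph_int /=.
by rewrite -!rformE.
Qed.

(** The trace formula writes <v,v> as a sum of real squares; if all of them vanish, [v] is
    orthogonal to every root. The hypothesis on [v] is also met by differences of roots. *)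
Lemma rform_pos v : (forall a, is_root a -> weight_form a v = (rform a v)%:C) ->
  v <> 0 -> 0 < rform v v.
Proof.
move=> vr v0.
have wr i : weight_form (w i) v = (rform (w i) v)%:C.
  have [wi|/eqP wi] := eqVneq (w i) 0; last exact/vr/(basis_weight_root eb we).
  by rewrite /rform wi (weight_form0l eb we simg nX).
have E : rform v v = \sum_i rform (w i) v ^+ 2.
  apply: (@complexI R); rewrite rmorph_sum /=.
  rewrite {1}/rform (weight_form_sum eb we simg nX) raddf_sum rmorph_sum.
  by apply: eq_bigr => i _ /=; rewrite wr -rmorphM /= expr2.
rewrite E lt_neqAle sumr_ge0 ?andbT => [|i _]; last exact: sqr_ge0.
apply/eqP => /esym/eqP; rewrite psumr_eq0 => [/allP z|i _]; last exact: sqr_ge0.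
apply: v0; apply: (weight_form_nondeg eb we simg nX) => b rb.
have [i wi] := root_basis_weight eb we rb.
have := z i (mem_index_enum i); rewrite /= sqrf_eq0 wi => /eqP b0.
by rewrite vr // b0.
Qed.

Lemma rform_root_pos a : is_root a -> 0 < rform a a.
Proof. by move=> ra; apply: rform_pos => [b rb|]; [exact: rformE|case: ra]. Qed.

Lemma rform_diff_pos a b : is_root a -> is_root b -> a <> b ->
  0 < rform (a - b) (a - b).
Proof.
move=> ra rb nab; apply: rform_pos => [c rc|/eqP].
  2: by rewrite subr_eq0 => /eqP.
rewrite rformC rformDl rformNl !(rformC _ c) rmorphB /= -!rformE //.
by rewrite wfD wfN.
Qed.

(** If a + b is not a root, then [n2] is 0 in [root_string_form], so 2<a,b> = n1<a,a> is
    nonnegative. *)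
Lemma rform_add_root a b : is_root a -> is_root b -> a + b <> 0 ->
  rform a b < 0 -> is_root (a + b).
Proof.
move=> ra rb ab0 neg; apply: contrapT => nr.
have pa := rform_root_pos ra.
have nab : b <> a by move=> ba; move: neg; rewrite ba ltNge ltW.
have [n1 [n2 [E _ _ /(_ nr) n20]]] :=
  root_string_form eb we simg nX two0 ra rb ab0 nab.
have : 2 * rform a b = n1%:R * rform a a.
  apply: (@complexI R); rewrite !rmorphM !rmorph_nat /=.
  by rewrite -!rformE // E n20 subr0.
have : 0 <= n1%:R * rform a a by rewrite mulr_ge0 // ltW.
lra.
Qed.

(* With q = 0 in the string of b, the integer p is 2<a,b>/<a,a>, so that
   b - p a is the reflection of b in a. *)
Lemma rform_reflect a b : is_root a -> is_root b -> b <> a ->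
  (forall k, is_root (b + a *+ k) -> k = 0%N) -> 0 < rform a b ->
  exists2 p : nat, 2 * rform a b = p%:R * rform a a & is_root (b - a *+ p).
Proof.
move=> ra rb nab top pos; have pa := rform_root_pos ra.
have ab0 : a + b <> 0.
  move=> ab0; have E : b = - a by apply/eqP; rewrite -addr_eq0 addrC ab0.
  by move: pos; rewrite E rformC rformNl oppr_gt0 ltNge ltW.
have nrab : ~ is_root (a + b).
  by move=> r; have := top 1%N; rewrite mulr1n addrC => /(_ r).
have [n1 [n2 [E n1r n1n /(_ nrab) n20]]] :=
  root_string_form eb we simg nX two0 ra rb ab0 nab.
have E1 : 2 * rform a b = n1%:R * rform a a.
  apply: (@complexI R); rewrite !rmorphM !rmorph_nat /=.
  by rewrite -!rformE // E n20 subr0.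
have q0 : string_length a b = 0%N.
  rewrite /string_length; apply: xget_subset1 => [|i j [/top -> _] [/top ->]//].
  by split=> [|k /top ->]; rewrite ?mulr0n ?addr0.
have rba : is_root (b - a).
  apply: contrapT => /n1n n10; move: E1; rewrite n10 mul0r; lra.
have n1p : n1 = string_length (- a) b by rewrite n1r // q0 addn0 muln1.
(* The default value 0 of [string_length] is harmless, since it gives the root [b] itself. *)
exists n1 => //; rewrite n1p /string_length; case: xgetP => [j -> [+ _]|_].
  by rewrite mulNrn.
by rewrite mulr0n subr0.
Qed.

End RealForm.

(** * Geometry of two orthogonal long roots *)

Section RootGeometry.
Variables (R : realFieldType) (W : zmodType) (rt : W -> Prop) (B : W -> W -> R).
Hypotheses (BC : forall a b, B a b = B b a)
  (BDl : forall a b c, B (a + b) c = B a c + B b c)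
  (BNl : forall a b, B (- a) b = - B a b)
  (Bpos : forall a, rt a -> 0 < B a a)
  (Bdiff : forall a b, rt a -> rt b -> a <> b -> 0 < B (a - b) (a - b))
  (Bint : forall a b, rt a -> rt b -> exists m : int, 2 * B a b = m%:~R * B a a)
  (Badd : forall a b, rt a -> rt b -> a + b <> 0 -> B a b < 0 -> rt (a + b)).
Implicit Types a b x y : W.

Definition longest a := rt a /\ forall b, rt b -> B b b <= B a a.

Lemma bformDr a b c : B a (b + c) = B a b + B a c.
Proof. by rewrite BC BDl !(BC a). Qed.

Lemma bformNr a b : B a (- b) = - B a b.
Proof. by rewrite BC BNl BC. Qed.

Definition bformE := (BDl, bformDr, BNl, bformNr).

Lemma bformMnl a b k : B (a *+ k) b = k%:R * B a b.
Proof.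
elim: k => [|k IH]; last by rewrite mulrS BDl IH; ring.
by rewrite mulr0n mul0r; apply: (addrI (B 0 b)); rewrite -BDl !addr0.
Qed.

Lemma form_string a b k :
  B (b + a *+ k) (b + a *+ k) = B b b + 2 * k%:R * B a b + k%:R ^+ 2 * B a a.
Proof.
by rewrite BDl !bformDr !bformMnl !(BC _ (a *+ k)) !bformMnl; ring.
Qed.

(** From 0 < |b - m|^2 <= 2|m|^2 - 2<b,m> the integer 2<m,b>/<m,m> is less than 2. *)
Lemma longest_form_le m b : longest m -> rt b -> b <> m -> 2 * B b m <= B m m.
Proof.
move=> [rm Lm] rb nbm; have [k E] := Bint rm rb; have := Bdiff rb rm nbm.
rewrite !bformE (BC m b) => pos; have := Lm _ rb => le; have mp := Bpos rm.
rewrite -(BC m) E; rewrite BC in E.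
have k1 : (k <= 1)%R.
  rewrite -ltzD1 -(ltr_int R) intrD; change (1 + 1 : R) with (2 : R).
  by rewrite -(ltr_pM2r mp) -E; lra.
have : (k%:~R : R) <= 1 by rewrite -(ler_int R) in k1.
by move=> k1'; rewrite -[leRHS]mul1r ler_wpM2r // ltW.
Qed.

Lemma bformB_root a b : rt a -> rt (- b) -> a <> b -> 0 < B a b -> rt (a - b).
Proof.
move=> ra rb nab pos; apply: Badd => //; last by rewrite bformNr; lra.
by move/eqP; rewrite subr_eq0 => /eqP.
Qed.

(** The shifted vector pairs with [m] to <m,m>, too much for a root other than [m] by
    [longest_form_le]. This supplies the vanishing bracket in [nrv_chain]. *)
Lemma longest_shift m x y : longest m -> B x m = B y m -> x <> y ->
  ~ rt (m + (x - y)) /\ m + (x - y) <> 0.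
Proof.
move=> Lm xy nxy; have mp := Bpos (proj1 Lm).
have E : B (m + (x - y)) m = B m m by rewrite !bformE xy subrr addr0.
split=> [r|m0].
  have nm : m + (x - y) <> m.
    by rewrite -[X in _ <> X]addr0 => /addrI/eqP; rewrite subr_eq0 => /eqP.
  by have := longest_form_le Lm r nm; rewrite E; apply/negP; rewrite -ltNge; lra.
have := bformMnl 0 m 0; rewrite mul0r mulr0n -m0 E => E0.
by rewrite E0 ltxx in mp.
Qed.

Section TwoLong.
Variables mu eps gam : W.
Hypotheses (Lmu : longest mu) (Leps : longest eps)
  (sum_neq0 : mu + eps <> 0) (sum_nroot : ~ rt (mu + eps))
  (rgam : rt gam) (rtgam : rt (mu + eps - gam))
  (gam_mu : gam <> mu) (gam_eps : gam <> eps).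
Local Notation nu := (mu + eps).
Local Notation L := (B mu mu).

Lemma long_norm : B eps eps = L.
Proof.
by apply/le_anti; rewrite (proj2 Lmu) ?(proj2 Leps) //; [case: Lmu|case: Leps].
Qed.

Let rmu : rt mu := proj1 Lmu.
Let reps : rt eps := proj1 Leps.
Let Lpos : 0 < L := Bpos rmu.

Lemma theta_neq x : x <> mu -> x <> eps -> nu - x <> mu /\ nu - x <> eps.
Proof.
move=> xm xe; split=> E; [apply: xe|apply: xm]; apply: (addIr (nu - x)).
  by rewrite {2}E addrC subrK addrC.
by rewrite {2}E addrC subrK.
Qed.

Lemma pair_le x : rt x -> x <> mu -> x <> eps ->
  2 * B x mu <= L /\ 2 * B x eps <= L.
Proof.
by move=> rx xm xe; rewrite -{2}long_norm; split; apply: longest_form_le.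
Qed.

(** A negative value would make [mu + eps] a root; adding the bounds of [pair_le] for [gam] and
    [nu - gam] excludes a positive one. *)
Lemma long_orth : B mu eps = 0.
Proof.
have [gm ge] := pair_le rgam gam_mu gam_eps.
have [tm te] := theta_neq gam_mu gam_eps; have [tm' te'] := pair_le rtgam tm te.
have nn : 0 <= B mu eps.
  by rewrite leNgt; apply/negP => /(Badd rmu reps sum_neq0).
have [k E] := Bint rmu reps.
have k0 : (0 <= k)%R.
  by rewrite -(ler_int R) -(ler_pM2r Lpos) mul0r -E mulr_ge0.
have k1 : (k < 1)%R.
  rewrite -(ltr_int R) -(ltr_pM2r Lpos) mul1r -E.
  have := Lpos; have := long_norm; move: tm' te'; rewrite !bformE (BC eps mu); lra.
have k00 : k = 0 by lia.
by move: E; rewrite k00 mul0r; lra.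
Qed.

Section Pair.
Variable x : W.
Hypotheses (rx : rt x) (rtx : rt (nu - x)) (xmu : x <> mu) (xeps : x <> eps).

(** Both [x] and [nu - x] pair with [mu] to at most L/2, and by orthogonality the two values add up
    to L; likewise for [eps]. *)
Lemma pair_form : B x mu = L / 2 /\ B x eps = L / 2.
Proof.
have [gm ge] := pair_le rx xmu xeps.
have [tm te] := theta_neq xmu xeps; have [tm' te'] := pair_le rtx tm te.
have := long_norm; have := long_orth.
move: tm' te'; rewrite !bformE (BC eps mu); lra.
Qed.

Lemma pair_theta_norm : B (nu - x) (nu - x) = B x x.
Proof.
have [gm ge] := pair_form; have := long_norm; have := long_orth.
rewrite !bformE !(BC _ x) (BC eps mu) gm ge; lra.
Qed.

(** The integer 2<x,mu>/<x,x> equals L/<x,x>. If [x] differs from [nu - x], positivity of |2x -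
    nu|^2 = 4<x,x> - 2L makes this integer less than 2, hence 1. *)
Lemma pair_norm : B x x = L \/ B x x = L / 2 /\ x = nu - x.
Proof.
have [gm ge] := pair_form; have ln := long_norm; have lo := long_orth.
have xp := Bpos rx; have [k E] := Bint rx rmu.
have xL : B x x <= L by exact: (proj2 Lmu).
have k0 : (0 < k)%R.
  by rewrite -(ltr_int R) -(ltr_pM2r xp) mul0r -E gm; have := Lpos; lra.
have [xt|/eqP xt] := eqVneq x (nu - x).
  right; split=> //; have : B x x = B x (nu - x) by rewrite -xt.
  by rewrite !bformE gm ge; lra.
have := Bdiff rx rtx xt => pos; left; suff k1 : k = 1.
  by move: E; rewrite k1 mul1r gm; lra.
suff : (k < 2)%R by lia.
rewrite -(ltr_int R) -(ltr_pM2r xp) -E gm; move: pos.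
by have := Lpos; rewrite !bformE !(BC _ x) (BC eps mu) gm ge; lra.
Qed.

End Pair.

Section TwoPairs.
Variable alf : W.
Hypotheses (ralf : rt alf) (rtalf : rt (nu - alf)) (alf_mu : alf <> mu)
  (alf_eps : alf <> eps) (gam_alf : gam <> alf) (gam_talf : gam <> nu - alf)
  (gam_tgam : gam <> nu - gam).

Lemma pair_gam_norm : B gam gam = L.
Proof.
by case: (pair_norm rgam rtgam gam_mu gam_eps) => // -[_ /gam_tgam].
Qed.

(** If [alf] is long, so is [nu - alf], and both pair with [gam] to at most L/2 with sum L;
    otherwise 2 alf = nu and <nu,gam> = L. *)
Lemma pair_alf_gam : B alf gam = L / 2.
Proof.
have [gm ge] := pair_form rgam rtgam gam_mu gam_eps.
have E : B (nu - alf) gam = L - B alf gam.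
  by rewrite !bformE !(BC _ gam) gm ge; lra.
case: (pair_norm ralf rtalf alf_mu alf_eps) => [aL|[_ aE]].
  have La : longest alf by split=> // b rb; rewrite aL; exact: (proj2 Lmu).
  have Lta : longest (nu - alf).
    by split=> // b rb; rewrite pair_theta_norm // aL; exact: (proj2 Lmu).
  have := longest_form_le La rgam gam_alf.
  have := longest_form_le Lta rgam gam_talf.
  by rewrite pair_theta_norm // !(BC gam) E aL; lra.
by move: E; rewrite -aE; lra.
Qed.

Lemma pair_gram :
  [/\ B (nu - alf) (nu - gam) = L / 2,
      B (mu - alf) (mu - alf) = B alf alf,
      B (alf - gam) (alf - gam) = B alf alf &
      B (mu - alf) (alf - gam) = L / 2 - B alf alf].
Proof.
have [gm ge] := pair_form rgam rtgam gam_mu gam_eps.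
have [am ae] := pair_form ralf rtalf alf_mu alf_eps.
have ag := pair_alf_gam; have gg := pair_gam_norm.
have ln := long_norm; have lo := long_orth.
rewrite !bformE !(BC _ alf) !(BC _ gam) (BC eps mu) (BC gam alf).
rewrite am ae gm ge ag gg ln lo.
by split; lra.
Qed.

End TwoPairs.
End TwoLong.
End RootGeometry.

(** * Simple roots *)

Lemma string_length_eq (K : fieldType) (g : lieAlgType K) (h : {vspace g})
    (a b : weight h) j :
  is_root (b + a *+ j) -> (forall k, is_root (b + a *+ k) -> (k <= j)%N) ->
  string_length a b = j.
Proof.
move=> rj jmax; rewrite /string_length; apply: xget_subset1 => [|i i'].
  by split.
move=> [ri imax] [ri' imax']; apply/eqP; rewrite eqn_leq.
by rewrite imax' ?imax.
Qed.

Section SimpleCoefficients.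
Variables (K : numFieldType) (g : lieAlgType K) (h : {vspace g}).
Variables (n : nat) (Pi : 'I_n -> weight h) (q : 'I_n).
Hypothesis ssPi : simple_system Pi.

Lemma simple_coef_inj (c d : 'I_n -> int) :
  \sum_i Pi i *~ c i = \sum_i Pi i *~ d i -> c =1 d.
Proof.
case: ssPi => _ frPi _ cd i.
have /freeP fr : free [tuple Pi i | i < n] by exact: frPi.
have := fr (fun i => (c i - d i)%:~R) _ i.
move=> H; apply/eqP; rewrite -subr_eq0 -(intr_eq0 K); apply/eqP; apply: H.
under eq_bigr => j _ do rewrite -tnth_nth tnth_mktuple scaler_int mulrzBr.
by rewrite sumrB cd subrr.
Qed.

Lemma root_coef_inj a k l : root_coef Pi q a k -> root_coef Pi q a l -> k = l.
Proof.
by move=> [c aE <-] [d]; rewrite aE => /simple_coef_inj cd <-; rewrite cd.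
Qed.

Lemma root_coefD a b k l : root_coef Pi q a k -> root_coef Pi q b l ->
  root_coef Pi q (a + b) (k + l).
Proof.
move=> [c -> <-] [d -> <-]; exists (fun i => c i + d i) => //.
by rewrite -big_split; apply: eq_bigr => i _; rewrite mulrzDr.
Qed.

Lemma root_coefN a k : root_coef Pi q a k -> root_coef Pi q (- a) (- k).
Proof.
move=> [c -> <-]; exists (fun i => - c i) => //.
by rewrite -sumrN; apply: eq_bigr => i _; rewrite mulrNz.
Qed.

(** The coefficient 1 at [q] rules out that [a] is a negative root. *)
Lemma degree1_root_nonneg a (c : 'I_n -> int) : is_root a ->
  a = \sum_i Pi i *~ c i -> c q = 1 ->
  exists2 d : 'I_n -> nat, a = \sum_i Pi i *+ d i & forall i, c i = d i.
Proof.
case: (ssPi) => _ _ dich ra aE cq; case: (dich a ra) => -[d dE].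
  exists d => //; apply: simple_coef_inj; rewrite -aE dE.
  by apply: eq_bigr => i _; rewrite pmulrn.
have cd : c =1 (fun i => - (d i)%:Z).
  apply: simple_coef_inj; rewrite -aE -[a]opprK dE -sumrN.
  by apply: eq_bigr => i _; rewrite mulrNz pmulrn.
by have := cd q; rewrite cq; lia.
Qed.

End SimpleCoefficients.

(** * The length of the simple root [Pi q] *)

Section LongRoots.
Variables (R : realType) (g : lieAlgType R[i]) (h : {vspace g}).
Variables (e : (\dim (fullv : {vspace g})).-tuple g)
  (w : 'I_(\dim (fullv : {vspace g})) -> weight h).
Hypotheses (eb : basis_of fullv e) (we : forall i, weight_vector (w i) e`_i).
Variables (X : weight h -> g) (Hr : weight h -> subvs_of h)
  (N : weight h -> weight h -> R[i]).
Hypotheses (simg : simple_lie g) (nX : normalized_root_vectors X Hr N).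
Implicit Types a b c v : weight h.

Local Notation BC := (@rformC R g h).
Local Notation BDl := (rformDl eb we simg nX).
Local Notation BNl := (rformNl eb we simg nX).
Local Notation Bpos := (rform_root_pos eb we simg nX).
Local Notation Bdiff := (rform_diff_pos eb we simg nX).
Local Notation Bint := (rform_int eb we simg nX).
Local Notation Badd := (rform_add_root eb we simg nX).
Local Notation longest := (longest (@is_root _ g h) (@rform R g h)).

Lemma long_root_longest a : long_root a -> longest a.
Proof.
move=> [ra la]; split=> // b rb.
by have := la b rb; rewrite !(rformE eb we simg nX) // lecR.
Qed.

Lemma rform_comb n (F : 'I_n -> weight h) (c : 'I_n -> nat) b :
  rform (\sum_i F i *+ c i) b = \sum_i (c i)%:R * rform (F i) b.
Proof.
rewrite (big_morph (fun a => rform a b) (id1 := 0) (op1 := +%R)) //=.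
- by apply: eq_bigr => i _; rewrite (bformMnl BDl).
- by move=> x y; exact: BDl.
- by have := bformMnl BDl 0 b 0; rewrite mulr0n mul0r.
Qed.

Section SimpleLong.
Variables (n : nat) (Pi : 'I_n -> weight h) (q : 'I_n).
Hypothesis ssPi : simple_system Pi.

(* Reflecting a longest root of degree 1 in simple roots other than Pi q lowers
   its height and keeps its length and degree; when no reflection applies,
   <b, b> <= <b, Pi q> forces b = Pi q. *)
Lemma degree1_longest_norm b (c : 'I_n -> nat) : longest b ->
  b = \sum_i Pi i *+ c i -> c q = 1%N -> rform (Pi q) (Pi q) = rform b b.
Proof.
have [m] := ubnP (\sum_i c i)%N; elim: m b c => // m IH b c lem lb bE cq.
have [rb Lb] := lb; case: (ssPi) => rPi _ _.
case: (pselect (exists2 i, i != q & 0 < rform (Pi i) b)) => [[i iq pos]|noi].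
  have PiE : Pi i = \sum_j Pi j *~ (j == i)%:Z.
    rewrite (bigD1 i) //= eqxx mulr1z big1 ?addr0 // => j ji.
    by rewrite (negPf ji) mulr0z.
  have bE' : b = \sum_j Pi j *~ (c j)%:Z.
    by rewrite bE; apply: eq_bigr => j _; rewrite pmulrn.
  have bPi : b <> Pi i.
    move=> bPi.
    have := simple_coef_inj ssPi (etrans (esym bE') (etrans bPi PiE)) q.
    by rewrite cq eq_sym (negPf iq).
  have ppi := Bpos (rPi i).
  (* Since <Pi i,b> > 0, every b + k Pi i with k > 0 is longer than the longest root [b]. *)
  have top k : is_root (b + Pi i *+ k) -> k = 0%N.
    case: k => // k /Lb; rewrite (form_string BC BDl) -addrA gerDl leNgt.
    by rewrite addr_gt0 ?mulr_gt0 ?exprn_gt0.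
  have [p pE rb'] := rform_reflect eb we simg nX (rPi i) rb bPi top pos.
  have p0 : (0 < p)%N.
    rewrite lt0n; apply: contraTneq pos => p0; rewrite -leNgt.
    by move: pE; rewrite p0 mul0r; lra.
  have nb' : rform (b - Pi i *+ p) (b - Pi i *+ p) = rform b b.
    rewrite -mulNrn (form_string BC BDl) !(BNl, bformNr BC BNl) opprK.
    have -> : p%:R ^+ 2 * rform (Pi i) (Pi i) = p%:R * (2 * rform (Pi i) b).
      by rewrite pE; ring.
    ring.
  pose c' j : int := (c j)%:Z - p%:Z * (j == i)%:Z.
  have b'E : b - Pi i *+ p = \sum_j Pi j *~ c' j.
    under [RHS]eq_bigr => j _ do rewrite mulrzBr.
    rewrite sumrB -bE'; congr (_ - _); rewrite {1}PiE -sumrMnl.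
    by apply: eq_bigr => j _; rewrite mulrC mulrzA pmulrn.
  have c'q : c' q = 1 by rewrite /c' cq eq_sym (negPf iq) mulr0 subr0.
  have [d dE cd] := degree1_root_nonneg ssPi rb' b'E c'q.
  rewrite -nb'; apply: (IH _ d _ _ dE); last by have := cd q; rewrite c'q => -[].
    (* The height drops by [p]; it is computed over the integers because the coefficients [c']
       involve a subtraction. *)
    have sumE : (\sum_j d j + p)%N = (\sum_j c j)%N.
      have one : \sum_j (j == i)%:R = 1 :> int.
        by rewrite (bigD1 i) //= eqxx big1 ?addr0 // => j /negPf ->.
      have : ((\sum_j d j + p)%N)%:R = ((\sum_j c j)%N)%:R :> int.
        rewrite natrD !natr_sum.
        have -> : \sum_j (d j)%:R =
            \sum_j ((c j)%:R - p%:R * (j == i)%:R) :> int.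
          by apply: eq_bigr => j _; rewrite !natz -cd.
        by rewrite sumrB -mulr_sumr one mulr1 subrK.
      by rewrite !natz => -[].
    by move: lem; rewrite -sumE; lia.
  by split=> // a ra; rewrite nb' Lb.
have le : rform b b <= rform (Pi q) b.
  rewrite {1}bE rform_comb (bigD1 q) //= cq mul1r -[leRHS]addr0 lerD2l.
  apply: sumr_le0 => i iq; rewrite mulr_ge0_le0 // leNgt; apply/negP => pos.
  by apply: noi; exists i.
have bp := Bpos rb.
have -> : Pi q = b; last by [].
apply: contrapT => nPi.
have := longest_form_le BC BDl BNl Bpos Bdiff Bint lb (rPi q) nPi.
by apply/negP; rewrite -ltNge; lra.
Qed.

End SimpleLong.
End LongRoots.

(** * Structure constants *)

(** Weights form no ring, so identities are evaluated at an element of [h], where [ring] applies. *)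
Ltac weight_ring :=
  apply/lfunP => ?; rewrite !(add_lfunE, opp_lfunE, zero_lfunE) /=; ring.

(** Bounding lengths along a root string gives a quadratic inequality in [k] with roots 0 and [j];
    this extracts the end of the string. *)
Lemma nat_quad_le (R : realFieldType) (L : R) (j k : nat) :
  0 < L -> k%:R * L * (k%:R - j%:R) <= 0 -> (k <= j)%N.
Proof.
move=> L0; rewrite leqNgt; apply: contraL => jk; rewrite -ltNge mulr_gt0 //.
  by rewrite mulr_gt0 // ltr0n (leq_trans _ jk).
by rewrite subr_gt0 ltr_nat.
Qed.

Section StructureConstants.
Variables (R : realType) (g : lieAlgType R[i]) (h : {vspace g}).
Variables (e : (\dim (fullv : {vspace g})).-tuple g)
  (w : 'I_(\dim (fullv : {vspace g})) -> weight h).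
Hypotheses (eb : basis_of fullv e) (we : forall i, weight_vector (w i) e`_i).
Variables (X : weight h -> g) (Hr : weight h -> subvs_of h)
  (N : weight h -> weight h -> R[i]).
Hypotheses (simg : simple_lie g) (nX : normalized_root_vectors X Hr N).
Implicit Types a b c v : weight h.

Local Notation BC := (@rformC R g h).
Local Notation BDl := (rformDl eb we simg nX).
Local Notation BNl := (rformNl eb we simg nX).
Local Notation Bpos := (rform_root_pos eb we simg nX).
Local Notation Bdiff := (rform_diff_pos eb we simg nX).
Local Notation Bint := (rform_int eb we simg nX).
Local Notation Badd := (rform_add_root eb we simg nX).
Local Notation longest := (longest (@is_root _ g h) (@rform R g h)).
Local Notation bE := (bformE BC BDl BNl).

(** Jacobi for X_m, X_{-a}, X_{a-c}, where [X_m, X_{a-c}] = 0, leaves N_{-a,a-c} N_{m,-c} on one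
    side; cyclicity turns N_{-a,a-c} into -N_{-a,c}, and multiplication by N_{a,-c} produces
    [kap]. *)
Lemma nrv_chain m a c (kap : R[i]) : is_root m -> is_root a -> is_root c ->
  is_root (m - a) -> is_root (a - c) -> is_root (m - c) ->
  ~ is_root (m + (a - c)) -> m + (a - c) <> 0 ->
  N a (- c) * N (- a) c = - kap ->
  N m (- a) * N (m - a) (a - c) * N a (- c) = kap * N m (- c).
Proof.
move=> rm ra rc rma rac rmc nr n0 kapE.
have [rNa rNc] := (root_opp eb we nX ra, root_opp eb we nX rc).
have nz b : is_root b -> b <> 0 by case.
have Ema : m - a + (a - c) = m - c by rewrite addrA subrK.
have Eac : - a + (a - c) = - c by rewrite addKr.
have := lie_lie (X m) (X (- a)) (X (a - c)).
rewrite (nrv_lie nX rm rNa (nz _ rma)) lieZl.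
rewrite (nrv_lie nX rma rac) Ema; last exact: nz.
rewrite (nrv_lie nX rNa rac) Eac; last exact: nz.
rewrite (nrv_lie nX rm rac n0) (nrv_nonroot nX rm rac nr n0) scale0r linear0 subr0.
rewrite lieZr (nrv_lie nX rm rNc (nz _ rmc)) !scalerA => /(nrv_inj nX rmc) ->.
have [|-> ->] := nrv_cyclic nX rNa rac rc; first by rewrite addKr addNr.
rewrite (nrvC nX rNa rc) ?mulNr; last first.
  by rewrite addrC -opprB => /eqP; rewrite oppr_eq0 => /eqP /(nz _ rac).
by rewrite -(opprK kap) -kapE; ring.
Qed.

Section Strings.
Variable L : R.
Hypotheses (L0 : 0 < L) (Lmax : forall c, is_root c -> rform c c <= L).

Lemma string_normP a b k : is_root (b + a *+ k) ->
  rform b b + 2 * k%:R * rform a b + k%:R ^+ 2 * rform a a <= L.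
Proof. by move=> /Lmax; rewrite (form_string BC BDl). Qed.

Lemma string_length0 a b : is_root b -> rform b b = L -> 0 < rform a a ->
  0 <= rform a b -> string_length a b = 0%N.
Proof.
move=> rb bb aa ab; apply: string_length_eq => [|k]; first by rewrite mulr0n addr0.
move=> /string_normP; rewrite bb => le; apply: (nat_quad_le aa); rewrite subr0.
have : 0 <= k%:R * rform a b by rewrite mulr_ge0.
by lra.
Qed.

Lemma nrv_prod_form a b q p : is_root a -> is_root b -> is_root (a + b) ->
  string_length a b = q -> string_length (- a) b = p ->
  (q * (1 + p))%:R * rform a a = L ->
  N a b * N (- a) (- b) = - (L / 2)%:C.
Proof.
move=> ra rb rab qE pE E.
rewrite (nrv_prod nX ra rb rab) qE pE (rformE eb we simg nX ra ra); congr (- _).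
by rewrite -E !rmorphM fmorphV !rmorph_nat /=; ring.
Qed.

(** The [a]-string through [b] is b, b + a: any further term would exceed the length bound. *)
Lemma nrv_prod_long a b : is_root a -> is_root b -> is_root (a + b) ->
  rform a a = L -> rform b b = L -> rform a b = - (L / 2) ->
  N a b * N (- a) (- b) = - (L / 2)%:C.
Proof.
move=> ra rb rab aa bb ab; apply: (nrv_prod_form (q := 1) (p := 0)) => //.
- apply: string_length_eq => [|k /string_normP]; first by rewrite mulr1n addrC.
  by rewrite aa bb ab => le; apply: (nat_quad_le L0); lra.
- by apply: string_length0; rewrite ?(BNl, bformNr BC BNl, opprK, aa, ab) //
    divr_ge0 ?ltW.
- by rewrite aa mul1r.
Qed.

(** The string is now b, b + a, b + 2a: the factor q = 2 compensates the halved <a,a>. *)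
Lemma nrv_prod_short a b : is_root a -> is_root b -> is_root (a + b) ->
  is_root (b + a *+ 2) ->
  rform a a = L / 2 -> rform b b = L -> rform a b = - (L / 2) ->
  N a b * N (- a) (- b) = - (L / 2)%:C.
Proof.
move=> ra rb rab rab2 aa bb ab; apply: (nrv_prod_form (q := 2) (p := 0)) => //.
- apply: string_length_eq => [//|k /string_normP].
  by rewrite aa bb ab => le; apply: (nat_quad_le L0); lra.
- by apply: string_length0; rewrite ?(BNl, bformNr BC BNl, opprK, aa, ab) //
    ?divr_gt0 ?divr_ge0 ?ltW.
- by rewrite aa; lra.
Qed.

(** The string is b - a, b, b + a: here the factor 1 + p = 2 compensates the halved <a,a>. *)
Lemma nrv_prod_orth a b : is_root a -> is_root b -> is_root (a + b) ->
  is_root (b - a) ->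
  rform a a = L / 2 -> rform b b = L / 2 -> rform a b = 0 ->
  N a b * N (- a) (- b) = - (L / 2)%:C.
Proof.
move=> ra rb rab rba aa bb ab.
have bound (k : nat) : k%:R ^+ 2 * (L / 2) <= L / 2 -> (k <= 1)%N.
  case: k => [|[|k]] // le; exfalso; move: le; apply/negP; rewrite -ltNge.
  by rewrite ltr_pMl ?divr_gt0 // exprn_egt1 // ltr1n.
apply: (nrv_prod_form (q := 1) (p := 1)) => //.
- apply: string_length_eq => [|k /string_normP]; first by rewrite mulr1n addrC.
  by rewrite aa bb ab => le; apply: bound; lra.
- apply: string_length_eq => [|k /string_normP]; first by rewrite mulr1n.
  by rewrite !(BNl, bformNr BC BNl, opprK) aa bb ab => le; apply: bound; lra.
- by rewrite aa; lra.
Qed.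

End Strings.

End StructureConstants.

(** * The identity for the pair of roots [alf], [gam] *)

Section Core.
Variables (R : realType) (g : lieAlgType R[i]) (h : {vspace g}).
Variables (e : (\dim (fullv : {vspace g})).-tuple g)
  (w : 'I_(\dim (fullv : {vspace g})) -> weight h).
Hypotheses (eb : basis_of fullv e) (we : forall i, weight_vector (w i) e`_i).
Variables (X : weight h -> g) (Hr : weight h -> subvs_of h)
  (N : weight h -> weight h -> R[i]).
Hypotheses (simg : simple_lie g) (nX : normalized_root_vectors X Hr N).
Implicit Types a b c v : weight h.

Local Notation BC := (@rformC R g h).
Local Notation BDl := (rformDl eb we simg nX).
Local Notation BNl := (rformNl eb we simg nX).
Local Notation Bpos := (rform_root_pos eb we simg nX).
Local Notation Bdiff := (rform_diff_pos eb we simg nX).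
Local Notation Bint := (rform_int eb we simg nX).
Local Notation Badd := (rform_add_root eb we simg nX).
Local Notation longest := (longest (@is_root _ g h) (@rform R g h)).
Local Notation ropp := (root_opp eb we nX).

Variables mu eps gam alf : weight h.
Local Notation nu := (mu + eps).
Hypotheses (Lmu : longest mu) (Leps : longest eps)
  (sum_neq0 : nu <> 0) (sum_nroot : ~ is_root nu)
  (rgam : is_root gam) (rtgam : is_root (nu - gam))
  (gam_mu : gam <> mu) (gam_eps : gam <> eps)
  (ralf : is_root alf) (rtalf : is_root (nu - alf)) (alf_mu : alf <> mu)
  (alf_eps : alf <> eps) (gam_alf : gam <> alf) (gam_talf : gam <> nu - alf)
  (gam_tgam : gam <> nu - gam).
Local Notation L := (rform mu mu).

Lemma structure_constants_theta :
  N alf (- gam) * N mu (- alf) * N (- (nu - gam)) (nu - alf)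
    * N (- (nu - alf)) eps
  = N mu (eps - gam) * N eps (- gam) * (L / 2)%:C.
Proof.
have rmu : is_root mu := proj1 Lmu; have reps : is_root eps := proj1 Leps.
have L0 : 0 < L := Bpos rmu.
have Lmax : forall c, is_root c -> rform c c <= L := proj2 Lmu.
have L20 : 0 < L / 2 by rewrite divr_gt0.
have nz b : is_root b -> b <> 0 by case.
have pform := pair_form BC BDl BNl Bpos Bdiff Bint Badd Lmu Leps sum_neq0
  sum_nroot rgam rtgam gam_mu gam_eps.
have [gm ge] := pform _ rgam rtgam gam_mu gam_eps.
have [am ae] := pform _ ralf rtalf alf_mu alf_eps.
have tnorm := pair_theta_norm BC BDl BNl Bpos Bdiff Bint Badd Lmu Leps sum_neq0
  sum_nroot rgam rtgam gam_mu gam_eps.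
have ag := pair_alf_gam BC BDl BNl Bpos Bdiff Bint Badd Lmu Leps sum_neq0
  sum_nroot rgam rtgam gam_mu gam_eps ralf rtalf alf_mu alf_eps gam_alf gam_talf.
have gg := pair_gam_norm BC BDl BNl Bpos Bdiff Bint Badd Lmu Leps sum_neq0
  sum_nroot rgam rtgam gam_mu gam_eps gam_tgam.
have [tat maa agag maag] := pair_gram BC BDl BNl Bpos Bdiff Bint Badd Lmu Leps
  sum_neq0 sum_nroot rgam rtgam gam_mu gam_eps ralf rtalf alf_mu alf_eps gam_alf
  gam_talf gam_tgam.
have rB a b : is_root a -> is_root b -> a <> b -> rform a b = L / 2 ->
    is_root (a - b).
  move=> ra rb nab ab; apply: (bformB_root BC BNl Badd) => //; last by rewrite ab.
  exact: ropp.
have rma : is_root (mu - alf) by apply: rB => //; [exact/nesym|rewrite BC].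
have rmg : is_root (mu - gam) by apply: rB => //; [exact/nesym|rewrite BC].
have reg : is_root (eps - gam) by apply: rB => //; [exact/nesym|rewrite BC].
have rag : is_root (alf - gam) by apply: rB => //; exact/nesym.
(* Differences change sign under theta, so the Jacobi chain for eps, theta(alf), theta(gam) runs
   through the negatives of mu - alf, mu - gam and alf - gam. *)
have Eta : eps - (nu - alf) = - (mu - alf) by weight_ring.
have Etg : eps - (nu - gam) = - (mu - gam) by weight_ring.
have Etat : nu - alf - (nu - gam) = - (alf - gam) by weight_ring.
have [rtag retg reta] : [/\ is_root (nu - alf - (nu - gam)),
    is_root (eps - (nu - gam)) & is_root (eps - (nu - alf))].
  by rewrite Eta Etg Etat; split; exact: ropp.
have [rNta rNtg] := (ropp rtalf, ropp rtgam).
have [rNa rNg] := (ropp ralf, ropp rgam).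
have ngg : rform (- gam) (- gam) = L by rewrite BNl (bformNr BC BNl) opprK gg.
have nag : rform alf (- gam) = - (L / 2) by rewrite (bformNr BC BNl) ag.
have ntgg : rform (- (nu - gam)) (- (nu - gam)) = L.
  by rewrite BNl (bformNr BC BNl) opprK tnorm.
have ntag : rform (nu - alf) (- (nu - gam)) = - (L / 2).
  by rewrite (bformNr BC BNl) tat.
have [k1 k2 k3] : [/\ N alf (- gam) * N (- alf) gam = - (L / 2)%:C,
   N (nu - alf) (- (nu - gam)) * N (- (nu - alf)) (nu - gam) = - (L / 2)%:C &
   N (mu - alf) (alf - gam) * N (- (mu - alf)) (- (alf - gam)) = - (L / 2)%:C].
  rewrite -[X in N (- alf) X]opprK -[X in N (- (nu - alf)) X]opprK.
  have rsum : is_root (mu - alf + (alf - gam)) by rewrite addrA subrK.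
  case: (pair_norm BC BDl BNl Bpos Bdiff Bint Badd Lmu Leps sum_neq0
    sum_nroot rgam rtgam gam_mu gam_eps ralf rtalf alf_mu alf_eps) => [aL|[aL aE]].
    split; apply: (nrv_prod_long eb we simg nX L0 Lmax) => //.
    - by rewrite tnorm.
    - by rewrite maa.
    - by rewrite agag.
    - by rewrite maag aL; lra.
  (* Because 2 alf = nu, the extra roots required in the three strings are nu - gam, gam and eps -
     gam. *)
  have nuE : nu = alf *+ 2 by rewrite mulr2n {2}aE addrC subrK.
  split.
  - apply: (nrv_prod_short eb we simg nX L0 Lmax) => //.
    by rewrite -nuE addrC.
  - apply: (nrv_prod_short eb we simg nX L0 Lmax) => //.
      by rewrite -aE -nuE addrC opprB addrC subrK.
    by rewrite tnorm.
  - apply: (nrv_prod_orth eb we simg nX L0 Lmax) => //.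
    + suff -> : alf - gam - (mu - alf) = eps - gam by [].
      have -> : alf - gam - (mu - alf) = alf *+ 2 - gam - mu.
        by rewrite mulr2n; weight_ring.
      by rewrite -nuE; weight_ring.
    + by rewrite maa.
    + by rewrite agag.
    + by rewrite maag aL subrr.
have [ns1 nn1] := longest_shift BC BDl BNl Bpos Bdiff Bint Lmu
  (etrans am (esym gm)) (nesym gam_alf).
have c1 := nrv_chain eb we nX rmu ralf rgam rma rag rmg ns1 nn1 k1.
have Estep : nu - alf - (nu - gam) = gam - alf by weight_ring.
have [ns2 nn2] : ~ is_root (eps + (nu - alf - (nu - gam))) /\
    eps + (nu - alf - (nu - gam)) <> 0.
  rewrite Estep; apply: (longest_shift BC BDl BNl Bpos Bdiff Bint Leps) => //.
  by rewrite ge ae.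
have c2 := nrv_chain eb we nX reps rtalf rtgam reta rtag retg ns2 nn2 k2.
rewrite Eta Etat in c2.
have [rNma rNag] := (ropp rma, ropp rag).
(* Jacobi for X_mu, X_eps and X_-gam, where [X_mu, X_eps] = 0. *)
have quad : N mu (eps - gam) * N eps (- gam) =
    - (N mu (- gam) * N eps (- (nu - gam))).
  have Etg1 : mu + (eps - gam) = nu - gam by weight_ring.
  have Etg2 : eps + (mu - gam) = nu - gam by weight_ring.
  have := lie_lie (X mu) (X eps) (X (- gam)).
  rewrite (nrv_lie nX rmu reps sum_neq0).
  rewrite (nrv_nonroot nX rmu reps sum_nroot sum_neq0).
  rewrite scale0r lie0l (nrv_lie nX reps rNg (nz _ reg)) lieZr.
  rewrite (nrv_lie nX rmu rNg (nz _ rmg)) lieZr.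
  rewrite (nrv_lie nX rmu reg) Etg1; last exact: nz.
  rewrite (nrv_lie nX reps rmg) Etg2; last exact: nz.
  rewrite !scalerA => /esym/eqP; rewrite subr_eq0 => /eqP/(nrv_inj nX rtgam) E.
  rewrite mulrC E -mulrN; congr (_ * _).
  (* Cyclicity on this zero-sum triple turns N_{eps,mu-gam} into -N_{eps,-theta(gam)}. *)
  have [|-> ->] := nrv_cyclic nX reps rmg rNtg; first by rewrite Etg2 subrr.
  by rewrite (nrvC nX reps rNtg) //; exact: nz.
have s1 : N (- (nu - gam)) (nu - alf) = - N (nu - alf) (- (nu - gam)).
  by rewrite (nrvC nX rtalf rNtg) //; exact: nz.
have s2 : N (- (nu - alf)) eps = - N eps (- (nu - alf)).
  by rewrite (nrvC nX reps rNta) //; exact: nz.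
have L2 : (L / 2)%:C != 0 :> R[i].
  by apply/eqP => /(@complexI R (L / 2) 0) L20'; move: L20; rewrite L20' ltxx.
(* Multiplying by L/2 and expanding it on the left through [k3] supplies the two middle factors that
   complete the chains [c1] and [c2]. *)
rewrite s1 s2 quad; apply: (mulfI L2).
set K := (L / 2)%:C in c1 c2 k3 *.
have k3' : K = - (N (mu - alf) (alf - gam) * N (- (mu - alf)) (- (alf - gam))).
  by rewrite k3 opprK.
rewrite [in LHS]k3'.
transitivity (- ((N mu (- alf) * N (mu - alf) (alf - gam) * N alf (- gam)) *
  (N eps (- (nu - alf)) * N (- (mu - alf)) (- (alf - gam))
     * N (nu - alf) (- (nu - gam))))).
  by ring.
by rewrite c1 c2; ring.
Qed.

End Core.

Theorem lemma6p39 (R : realType) (g : lieAlgType R[i]) (b h : {vspace g})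
  (T : lie_type) (Pi : 'I_(lie_rank T) -> weight h) (q : 'I_(lie_rank T))
  (X : weight h -> g) (Hr : weight h -> subvs_of h)
  (N : weight h -> weight h -> R[i])
  (mu gam eps : weight h) (V : {vspace tensor_sq g}) :
  simple_lie g ->
  cartan_subalgebra h ->
  borel_subalgebra b ->
  (h <= b)%VS ->
  simple_system Pi ->
  (forall a : weight h, positive_root Pi a <-> roots_of b a) ->
  has_type Pi ->
  listed_type T q.+1 ->
  quasi_heisenberg Pi q ->
  normalized_root_vectors X Hr N ->
  highest_weight Pi q lie (g_one Pi q) mu ->
  highest_weight Pi q lie (z_nilrad Pi q) gam ->
  roots_of (g_one Pi q) eps ->
  special_constituent Pi q mu gam V (mu + eps) ->
  type_1a mu eps ->
  let theta (beta : weight h) := (mu + eps) - beta in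
  forall alpha gamj : weight h,
    roots_of_at (mu + eps) (g_one Pi q) alpha ->
    alpha <> mu -> alpha <> eps ->
    roots_of_at (mu + eps) (z_nilrad Pi q) gamj ->
    N alpha (- gamj) * N mu (- alpha)
      * N (- theta gamj) (theta alpha) * N (- theta alpha) (theta mu)
    = N mu (eps - gamj) * N eps (- gamj)
      * (weight_form (Pi q) (Pi q) / 2).
Proof.
move=> simg hC _ _ ssPi _ _ _ _ nX mu1 _ eps1 _ [sum_nroot _ mu_long eps_long].
move=> theta alpha gamj [alpha1 rtalf] alf_mu alf_eps [gamj2 rtgam].
have [e [w [eb we]]] := weight_basis hC.
have [reps deps] := roots_of_sum_root_spaces eb we eps1.
have [ralf dalf] := roots_of_sum_root_spaces eb we alpha1.
have [rgam dgam] := roots_of_sum_root_spaces eb we gamj2.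
(* A highest weight vector of g(1) is a nonzero vector of weight [mu], so [mu] is one of the roots
   of degree 1. *)
have [rmu dmu] : is_root mu /\ root_coef Pi q mu 1.
  have [x [xg /eqP x0 xmu _]] := mu1.
  exact: (sum_root_spaces_weight eb we xg xmu x0).
(* The remaining inequalities between weights come from their coefficients at [q]: 1 for mu, eps,
   alpha and theta(alpha), 2 for gamma_j and mu + eps, 0 for theta(gamma_j) and the zero weight. *)
have dnu := root_coefD dmu deps.
have dB := fun a k da => root_coefD dnu (root_coefN (a := a) (k := k) da).
have neq a a' k k' : root_coef Pi q a k -> root_coef Pi q a' k' ->
    k <> k' -> a <> a'.
  move=> da da' kk' aa'; apply: kk'; rewrite aa' in da.
  exact: root_coef_inj da da'.
have d0 : root_coef Pi q 0 0.
  by exists (fun=> 0) => //; rewrite big1 // => i _; rewrite mulr0z.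
have Lmu := long_root_longest eb we simg nX mu_long.
have Leps := long_root_longest eb we simg nX eps_long.
have -> : weight_form (Pi q) (Pi q) / 2 = (rform mu mu / 2)%:C.
  have [c muE cq] := dmu; have [d muE' cd] := degree1_root_nonneg ssPi rmu muE cq.
  have dq : d q = 1%N by have := cd q; rewrite cq => -[].
  have rPi : is_root (Pi q) by case: ssPi.
  rewrite rmorphM fmorphV rmorph_nat /=.
  rewrite -(degree1_longest_norm eb we simg nX ssPi Lmu muE' dq).
  by rewrite -(rformE eb we simg nX).
rewrite /theta [mu + eps - mu]addrAC subrr add0r.
apply: (structure_constants_theta eb we simg nX) => //; by [
  exact: neq dnu d0 _ | exact: neq dgam dmu _ | exact: neq dgam deps _ |
  exact: neq dgam dalf _ | exact: neq dgam (dB _ _ dalf) _ |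
  exact: neq dgam (dB _ _ dgam) _].
Qed.
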